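(* There exist functions $f:\mathbb{N}\times\mathbb{N}\to\mathbb{N}$ and $g:\mathbb{N}\to\mathbb{N}$ with the following property. Let $n,d$ be positive integers and let $G$ be a locally graded group in which every subgroup is either subnormal in $G$ of defect at most $n$ or soluble of derived length at most $d$. Then either (i) $G$ is soluble of derived length at most $f(n,d)$, or (ii) there is an integer $r\le g(n)$ such that $G^{(r)}$ is finite, and $G$ has a normal subgroup $S$ which is soluble of derived length at most $d$ such that $G/S$ is a finite almost minimal simple group.
   Context: A group is locally graded if every non-trivial finitely generated subgroup has a non-trivial finite homomorphic image. A subgroup $H$ is subnormal of defect at most $n$ in $G$ if there is a chain $H=H_0\trianglelefteq H_1\trianglelefteq\cdots\trianglelefteq H_n=G$. $G^{(0)}=G$, $G^{(i+1)}=[G^{(i)},G^{(i)}]$. A minimal simple group is a non-abelian simple group all of whose proper subgroups are soluble. A group $X$ is almost minimal simple if there is a minimal simple group $M$ such that $X$ is isomorphic to a subgroup of $\mathrm{Aut}(M)$ containing $\mathrm{Inn}(M)$. *)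

(* Defs.v *)
From HB Require Import structures.
From Stdlib Require List.
From mathcomp Require Import all_boot all_fingroup all_solvable.
Set Implicit Arguments. Unset Strict Implicit. Unset Printing Implicit Defensive.

Record grp := Grp {
  carrier :> Type;
  gmul : carrier -> carrier -> carrier;
  ginv : carrier -> carrier;
  gone : carrier;
  gmulA : forall x y z, gmul x (gmul y z) = gmul (gmul x y) z;
  gmul1 : forall x, gmul gone x = x;
  gmulV : forall x, gmul (ginv x) x = gone
}.

Section AbstractGroups.
Variable G : grp.

Definition gsubset (A B : G -> Prop) := forall x, A x -> B x.
Definition full : G -> Prop := fun _ => True.

Definition is_subgroup (H : G -> Prop) :=
  H (gone G) /\ (forall x y, H x -> H y -> H (gmul x y)) /\
  (forall x, H x -> H (ginv x)).

Definition gconj (x y : G) := gmul (ginv y) (gmul x y).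
Definition gcomm (x y : G) := gmul (ginv x) (gconj x y).

Definition normal_in (H K : G -> Prop) :=
  is_subgroup H /\ is_subgroup K /\ gsubset H K /\
  (forall h k, H h -> K k -> H (gconj h k)).

Definition subnormal_le (H : G -> Prop) (n : nat) :=
  exists c : nat -> G -> Prop,
    (forall x, c 0 x <-> H x) /\ (forall x, c n x) /\
    (forall i, i < n -> normal_in (c i) (c i.+1)).

Inductive gen (A : G -> Prop) : G -> Prop :=
| gen_in x : A x -> gen A x
| gen_one : gen A (gone G)
| gen_mul x y : gen A x -> gen A y -> gen A (gmul x y)
| gen_inv x : gen A x -> gen A (ginv x).

Definition derived_subgroup (H : G -> Prop) : G -> Prop :=
  gen (fun z => exists a b, H a /\ H b /\ z = gcomm a b).
Fixpoint derived (i : nat) (H : G -> Prop) : G -> Prop :=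
  if i is i'.+1 then derived_subgroup (derived i' H) else H.

Definition soluble_le (H : G -> Prop) (d : nat) :=
  forall x, derived d H x -> x = gone G.

Definition finite_set (A : G -> Prop) :=
  exists l : seq G, forall x, A x -> List.In x l.

Definition nontrivial (H : G -> Prop) := exists x, H x /\ x <> gone G.

Definition has_nontrivial_finite_image (H : G -> Prop) :=
  exists (gT : finGroupType) (phi : G -> gT),
    (forall x y, H x -> H y -> phi (gmul x y) = (phi x * phi y)%g) /\
    (exists x, H x /\ phi x <> 1%g).

Definition locally_graded :=
  forall l : seq G,
    nontrivial (gen (fun x => List.In x l)) ->
    has_nontrivial_finite_image (gen (fun x => List.In x l)).

End AbstractGroups.
Arguments full G _ : clear implicits.

Definition minimal_simple (gT : finGroupType) (M : {group gT}) :=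
  simple M /\ ~~ abelian M /\
  (forall K : {group gT}, K \proper M -> solvable K).

Definition Inn (gT : finGroupType) (M : {group gT}) : {set {perm gT}} :=
  (conj_aut M @* M)%g.

Definition almost_minimal_simple (xT : finGroupType) (X : {group xT}) :=
  exists (mT : finGroupType) (M : {group mT}) (A : {group {perm mT}}),
    minimal_simple M /\ Inn M \subset A /\ A \subset Aut M /\ X \isog A.

Definition quotient_finite_ams (G : grp) (S : G -> Prop) :=
  exists (xT : finGroupType) (X : {group xT}) (phi : G -> xT),
    (forall x y, phi (gmul x y) = (phi x * phi y)%g) /\
    (forall x, phi x \in X) /\
    (forall y, y \in X -> exists x, phi x = y) /\
    (forall x, phi x = 1%g <-> S x) /\
    almost_minimal_simple X.

(* Main.v *)
Require Import Defs.
From Stdlib Require Import Classical ClassicalEpsilon ProofIrrelevance.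
From Stdlib Require Import FunctionalExtensionality PropExtensionality.
From Stdlib Require Import ZArith Lia.
From mathcomp Require classical_sets.
From mathcomp Require Import all_boot all_fingroup all_solvable.
From mathcomp Require Import zify.
Set Implicit Arguments. Unset Strict Implicit. Unset Printing Implicit Defensive.

(** If all subgroups of G are subnormal of defect at most n, then G is soluble of
    n-bounded derived length t.  By induction on n the factors of the normal closure
    series of a subgroup H give (H^G)^(s) <= H for a bounded s, and G is (n+1)-Engel.
    So a k-generator subgroup is soluble, hence nilpotent, of bounded class, and a normal
    subgroup L of G inside it has boundedly generated derived factors A.  Modulo A^q, q a
    prime power, the action of G on A is spanned by that of boundedly many elements, which
    generate a nilpotent group; hence L lies in a bounded term of the upper central series.
    With k = 2^s this term contains all s-th derived words, and so G^(s).

    In the theorem, let R = G^(nt).  If H is not soluble of derived length at most d, then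
    every subgroup above H is subnormal, so the factors of the normal closure series of H
    are soluble of derived length at most t, and R <= H.  Thus a subgroup either contains R
    or is soluble of derived length at most d.  If R is perfect and not soluble of derived
    length at most d, it is finitely generated, so it has a proper normal subgroup N of
    finite index, and N is soluble; Schur-Zassenhaus applied to the abelian sections of N
    shows that R is finite.  The soluble radical K of R is its largest proper normal
    subgroup, R/K is minimal simple, and S is the kernel of the action of G on R/K. *)

(** * Groups, normal closures and sections *)

(* Prime-power moduli make the bounds uniform. The number of elements of G whose action on A spans
   all the others must depend on the rank of A alone. Over the integers a spanning family may
   contain no spanning subfamily of size the rank (2 and 3 span Z, neither does alone). Over the
   local ring Z/q it always does, since one of any set of residues divides all the others. The bound
   does not involve q, and the subgroups A^q of a finitely generated abelian group intersect
   trivially, so the bound holds in A itself.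

   Since G need not be finitely generated, bounding the class of its finitely generated subgroups is
   not enough. Subgroups L normal in all of G are used because they land in the upper central series
   of G, one term of which contains arbitrarily many of them at once.

   The second half rests on one remark: a perfect group is never the product of a proper normal
   subgroup and a soluble subgroup. It excludes soluble Schur-Zassenhaus complements, and it makes
   the product of two proper normal subgroups of R proper. *)
Declare Scope grp_scope.
Infix "*g" := gmul (at level 40, left associativity) : grp_scope.
Local Open Scope grp_scope.

Section GroupLaws.
Variable G : grp.
Implicit Types x y z : G.

Lemma gmulVr x : x *g ginv x = gone G.
Proof.
rewrite -(gmul1 (x *g ginv x)) -(gmulV (ginv x)) -gmulA (gmulA (ginv x) x).
by rewrite gmulV gmul1.
Qed.

Lemma gmul1r x : x *g gone G = x.
Proof. by rewrite -(gmulV x) gmulA gmulVr gmul1. Qed.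

Lemma gmulKr x y : ginv x *g (x *g y) = y.
Proof. by rewrite gmulA gmulV gmul1. Qed.

Lemma gmulVKr x y : x *g (ginv x *g y) = y.
Proof. by rewrite gmulA gmulVr gmul1. Qed.

Lemma gmul_injl x y z : x *g y = x *g z -> y = z.
Proof. by move=> h; rewrite -(gmulKr x y) h gmulKr. Qed.

Lemma gmul_injr x y z : y *g x = z *g x -> y = z.
Proof. by move=> h; rewrite -(gmul1r y) -(gmulVr x) gmulA h -gmulA gmulVr gmul1r. Qed.

Lemma ginv1 : ginv (gone G) = gone G.
Proof. by rewrite -[LHS]gmul1r gmulV. Qed.

Lemma ginvK x : ginv (ginv x) = x.
Proof. by apply: (@gmul_injl (ginv x)); rewrite gmulVr gmulV. Qed.

Lemma ginvM x y : ginv (x *g y) = ginv y *g ginv x.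
Proof.
apply: (@gmul_injl (x *g y)).
by rewrite gmulVr -gmulA gmulVKr gmulVr.
Qed.

Lemma gmul_assoc x y z : (x *g y) *g z = x *g (y *g z).
Proof. by rewrite gmulA. Qed.

End GroupLaws.

(* The ten rules form a complete rewriting system for the free group, so
   [gsolve] decides identities valid in all groups. *)
Global Hint Rewrite gmul_assoc gmul1 gmul1r gmulV gmulVr gmulKr gmulVKr
  ginv1 ginvK ginvM : grp.
Ltac gnorm := rewrite /gcomm /gconj; autorewrite with grp.
Ltac gsolve := by gnorm.

Section Basics.
Variable G : grp.
Implicit Types (x y z g h : G) (A B H K N P S : G -> Prop).

Lemma gconjM x y g : gconj (x *g y) g = gconj x g *g gconj y g.
Proof. gsolve. Qed.

Lemma gconjV x g : gconj (ginv x) g = ginv (gconj x g).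
Proof. gsolve. Qed.

Lemma gconj1 g : gconj (gone G) g = gone G.
Proof. gsolve. Qed.

Lemma gconjJ x g h : gconj (gconj x g) h = gconj x (g *g h).
Proof. gsolve. Qed.

Lemma gconjg1 x : gconj x (gone G) = x.
Proof. gsolve. Qed.

Lemma gconjK x g : gconj (gconj x g) (ginv g) = x.
Proof. gsolve. Qed.

Lemma gconjKV x g : gconj (gconj x (ginv g)) g = x.
Proof. gsolve. Qed.

Lemma gconjR x y g : gconj (gcomm x y) g = gcomm (gconj x g) (gconj y g).
Proof. gsolve. Qed.

Lemma gconjE x g : gconj x g = x *g gcomm x g.
Proof. gsolve. Qed.

Lemma gcomm1 g : gcomm (gone G) g = gone G.
Proof. gsolve. Qed.

Lemma gcomm_eq1 x y : gcomm x y = gone G <-> x *g y = y *g x.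
Proof.
split=> h; last by rewrite /gcomm /gconj h; gsolve.
have -> : x *g y = y *g x *g gcomm x y by gsolve.
by rewrite h gmul1r.
Qed.

Lemma sub1 H : is_subgroup H -> H (gone G). Proof. by case. Qed.
Lemma subM H x y : is_subgroup H -> H x -> H y -> H (x *g y).
Proof. by case=> _ [h _]; apply: h. Qed.
Lemma subV H x : is_subgroup H -> H x -> H (ginv x).
Proof. by case=> _ [_ h]; apply: h. Qed.
Lemma subJ H x y : is_subgroup H -> H x -> H y -> H (gconj x y).
Proof. by move=> s hx hy; apply: subM => //; [apply: subV | apply: subM]. Qed.
Lemma subR H x y : is_subgroup H -> H x -> H y -> H (gcomm x y).
Proof. by move=> s hx hy; apply: subM => //; [apply: subV | apply: subJ]. Qed.
Lemma subMl H x y : is_subgroup H -> H x -> (H (x *g y) <-> H y).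
Proof.
move=> s hx; split=> [h|]; last exact: subM.
by rewrite -(gmulKr x y); apply: subM => //; apply: subV.
Qed.
Lemma subMr H x y : is_subgroup H -> H y -> (H (x *g y) <-> H x).
Proof.
move=> s hy; split=> [h|h]; last exact: subM.
have -> : x = x *g y *g ginv y by gsolve.
by apply: subM => //; apply: subV.
Qed.
Lemma sub_full : is_subgroup (full G). Proof. by []. Qed.

Lemma sub_triv : is_subgroup (fun x => x = gone G).
Proof. by split=> //; split=> [x y -> ->|x ->]; gsolve. Qed.

Lemma sub_ext H K : (forall x, H x <-> K x) -> is_subgroup H -> is_subgroup K.
Proof.
move=> e s; split; first by apply/e; apply: sub1.
by split=> [x y /e hx /e hy|x /e hx]; apply/e; [apply: subM | apply: subV].
Qed.

Lemma subI H K : is_subgroup H -> is_subgroup K -> is_subgroup (fun x => H x /\ K x).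
Proof.
move=> sH sK; split; first by split; apply: sub1.
by split=> [x y [? ?] [? ?]|x [? ?]]; split; (apply: subM || apply: subV).
Qed.

Lemma sub_gen A : is_subgroup (gen A).
Proof. by split; [apply: gen_one | split; [apply: gen_mul | apply: gen_inv]]. Qed.

Lemma gen_min A H : is_subgroup H -> gsubset A H -> gsubset (gen A) H.
Proof.
move=> s AH x; elim=> [y /AH //||y z _ hy _ hz|y _ hy].
- exact: sub1.
- exact: subM.
- exact: subV.
Qed.

Lemma gen_mono A B : gsubset A B -> gsubset (gen A) (gen B).
Proof. by move=> AB; apply: (gen_min (sub_gen B)) => x /AB; apply: gen_in. Qed.

Lemma gen_conj A (g : G) : (forall x, A x -> A (gconj x g)) ->
  forall x, gen A x -> gen A (gconj x g).
Proof.
move=> h x; elim=> [y /h ?||y z _ hy _ hz|y _ hy].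
- exact: gen_in.
- by rewrite gconj1; apply: gen_one.
- by rewrite gconjM; apply: gen_mul.
- by rewrite gconjV; apply: gen_inv.
Qed.

Definition ginvariant H S := forall x g, H x -> S g -> H (gconj x g).

Definition gnormal H := is_subgroup H /\ ginvariant H (full G).

Lemma gnormal_sub H : gnormal H -> is_subgroup H. Proof. by case. Qed.
Hint Resolve gnormal_sub : core.
Lemma gnormalJ H x g : gnormal H -> H x -> H (gconj x g).
Proof. by case=> _ h /h; apply. Qed.
Lemma gnormalRl H x g : gnormal H -> H x -> H (gcomm x g).
Proof.
move=> nH hx; apply: subM; [exact: gnormal_sub | | exact: gnormalJ].
by apply: subV => //; exact: gnormal_sub.
Qed.
Lemma gnormal_inE N : gnormal N -> normal_in N (full G).
Proof. by case=> s h; split. Qed.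

Lemma gnormal_triv : gnormal (fun x => x = gone G).
Proof. by split=> [|x g ->]; [apply: sub_triv | rewrite gconj1]. Qed.

Lemma gnormal_full : gnormal (full G). Proof. by split. Qed.

Lemma gnormal_gen A : (forall x g, A x -> A (gconj x g)) -> gnormal (gen A).
Proof.
move=> h; split; first exact: sub_gen.
by move=> x g hx _; apply: gen_conj hx => y; apply: h.
Qed.

(** The elements that commute with [g] modulo the normal subgroup [N] form a subgroup. *)
Lemma comm_gen_l N A g : gnormal N -> (forall a, A a -> N (gcomm a g)) ->
  forall a, gen A a -> N (gcomm a g).
Proof.
move=> nN h a; elim=> [y /h //||y z _ hy _ hz|y _ hy].
- by rewrite gcomm1; apply: sub1; apply: gnormal_sub.
- have -> : gcomm (y *g z) g = gconj (gcomm y g) z *g gcomm z g by gsolve.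
  by apply: subM => //; [apply: gnormal_sub | apply: gnormalJ].
- have -> : gcomm (ginv y) g = gconj (ginv (gcomm y g)) (ginv y) by gsolve.
  by apply: gnormalJ => //; apply: subV => //; apply: gnormal_sub.
Qed.

Lemma gcommV x y : ginv (gcomm x y) = gcomm y x.
Proof. gsolve. Qed.

Lemma comm_gen N A B : gnormal N -> (forall a b, A a -> B b -> N (gcomm a b)) ->
  forall a b, gen A a -> gen B b -> N (gcomm a b).
Proof.
move=> nN h a b ha hb; apply: (comm_gen_l nN _ ha) => {}a {}ha.
rewrite -gcommV; apply: subV; first exact: gnormal_sub.
apply: (comm_gen_l nN _ hb) => {}b {}hb.
by rewrite -gcommV; apply: subV; [exact: gnormal_sub | exact: h].
Qed.

Lemma sub_derived i H : is_subgroup H -> is_subgroup (derived i H).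
Proof. by case: i => //= i _; apply: sub_gen. Qed.

Lemma derived_mono i H K : gsubset H K -> gsubset (derived i H) (derived i K).
Proof.
elim: i => //= i IH HK; apply: gen_mono => z [a [b [ha [hb ->]]]].
by exists a, b; split; [|split]; rewrite //; apply: IH.
Qed.

Lemma derivedD i j H : derived (i + j) H = derived i (derived j H).
Proof. by elim: i => //= i ->. Qed.

Lemma derivedS i H : is_subgroup H -> gsubset (derived i.+1 H) (derived i H).
Proof.
move=> s; apply: gen_min; first exact: sub_derived.
by move=> z [a [b [ha [hb ->]]]]; apply: subR => //; apply: sub_derived.
Qed.

Lemma derived_le i j H : is_subgroup H -> i <= j -> gsubset (derived j H) (derived i H).
Proof.
move=> s /subnK <-; elim: (j - i) => [|m IH] x //; rewrite addSn => /(derivedS s).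
exact: IH.
Qed.

Lemma derived_sub i H : is_subgroup H -> gsubset (derived i H) H.
Proof. by move=> s; apply: (@derived_le 0). Qed.

Lemma derived_conj i H g : (forall x, H x -> H (gconj x g)) ->
  forall x, derived i H x -> derived i H (gconj x g).
Proof.
move=> h; elim: i => //= i IH; apply: gen_conj => z [a [b [ha [hb ->]]]].
by exists (gconj a g), (gconj b g); rewrite gconjR; split; [|split]; rewrite //; apply: IH.
Qed.

Lemma gnormal_derived i H : gnormal H -> gnormal (derived i H).
Proof.
move=> nH; split; first by apply: sub_derived; apply: gnormal_sub.
by move=> x g hx _; apply: derived_conj hx => y; apply: gnormalJ.
Qed.

Lemma soluble_leW H i j : is_subgroup H -> i <= j -> soluble_le H i -> soluble_le H j.
Proof. by move=> s ij h x hx; apply: h; apply: derived_le hx. Qed.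

Lemma derived_comm_triv H : (forall a b, H a -> H b -> a *g b = b *g a) ->
  forall x, derived 1 H x -> x = gone G.
Proof.
move=> h; apply: gen_min; first exact: sub_triv.
by move=> z [a [b [ha [hb ->]]]]; apply/gcomm_eq1; apply: h.
Qed.

Definition ncl A := gen (fun z => exists a g, A a /\ z = gconj a g).

Lemma gnormal_ncl A : gnormal (ncl A).
Proof. by apply: gnormal_gen => x g [a [k [ha ->]]]; exists a, (k *g g); rewrite gconjJ. Qed.

Lemma ncl_sub A : gsubset A (ncl A).
Proof. by move=> x hx; apply: gen_in; exists x, (gone G); rewrite gconjg1. Qed.

Definition glist (l : seq G) : G -> Prop := gen (fun x => List.In x l).

End Basics.

(** * Homomorphisms defined on a subgroup *)

Section Homs.
Variables (G Q : grp) (K : G -> Prop) (f : G -> Q).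
(** The map is total on the carrier but multiplicative only on [K], so a subgroup can be projected
    without becoming a type of its own. *)
Definition hom_on := forall x y, K x -> K y -> f (x *g y) = f x *g f y.
Hypotheses (sK : is_subgroup K) (hf : hom_on).
Implicit Types (x y : G) (H L : G -> Prop).

Definition img H : Q -> Prop := fun z => exists x, H x /\ f x = z.

Lemma hom1 : f (gone G) = gone Q.
Proof.
have k1 := sub1 sK; apply: (@gmul_injl _ (f (gone G))).
by rewrite -hf // gmul1 gmul1r.
Qed.

Lemma homV x : K x -> f (ginv x) = ginv (f x).
Proof.
move=> kx; apply: (@gmul_injl _ (f x)); rewrite -hf //; last exact: subV.
by rewrite !gmulVr hom1.
Qed.

Lemma homJ x y : K x -> K y -> f (gconj x y) = gconj (f x) (f y).
Proof.
move=> kx ky; rewrite /gconj hf ?homV ?hf //; [exact: subV | exact: subM].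
Qed.

Lemma homR x y : K x -> K y -> f (gcomm x y) = gcomm (f x) (f y).
Proof. by move=> kx ky; rewrite /gcomm hf ?homV ?homJ //; [exact: subV | exact: subJ]. Qed.

Lemma sub_img H : gsubset H K -> is_subgroup H -> is_subgroup (img H).
Proof.
move=> HK s; split; first by exists (gone G); rewrite hom1; split=> //; apply: sub1.
split=> [_ _ [x [hx <-]] [y [hy <-]]|_ [x [hx <-]]].
  by exists (x *g y); rewrite hf; try exact: HK; split=> //; apply: subM.
by exists (ginv x); rewrite homV; try exact: HK; split=> //; apply: subV.
Qed.

Lemma sub_preim (L : Q -> Prop) : is_subgroup L -> is_subgroup (fun x => K x /\ L (f x)).
Proof.
move=> s; split; first by rewrite hom1; split; apply: sub1.
split=> [x y [kx lx] [ky ly]|x [kx lx]].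
  by rewrite hf //; split; apply: subM.
by rewrite homV //; split; apply: subV.
Qed.

Lemma img_gen (A : G -> Prop) : gsubset A K -> forall x, gen A x -> gen (img A) (f x).
Proof.
move=> AK x hx.
suff: K x /\ gen (img A) (f x) by case.
apply: (gen_min (sub_preim (sub_gen (img A))) _ hx).
by move=> y hy; split; [apply: AK | apply: gen_in; exists y].
Qed.

Lemma gen_img (A : G -> Prop) : gsubset A K -> forall y : Q, gen (img A) y -> img (gen A) y.
Proof.
move=> AK; have gK : gsubset (gen A) K by apply: gen_min.
apply: gen_min; first by apply: sub_img => //; apply: sub_gen.
by move=> _ [x [hx <-]]; exists x; split=> //; apply: gen_in.
Qed.

Lemma img_derived i H : gsubset H K -> is_subgroup H ->
  forall x, derived i H x -> derived i (img H) (f x).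
Proof.
move=> HK s; elim: i => [|i IH] x /=; first by exists x.
have dK : gsubset (derived i H) K by move=> y /(derived_sub s) /HK.
have AK : gsubset (fun z => exists a b, derived i H a /\ derived i H b /\ z = gcomm a b) K.
  by move=> z [a [b [ha [hb ->]]]]; apply: subR => //; apply: dK.
move=> /(img_gen AK); apply: gen_mono => _ [z [[a [b [ha [hb ->]]]] <-]].
exists (f a), (f b); rewrite homR; try exact: dK.
by split; [exact: IH | split; [exact: IH|]].
Qed.

Lemma derived_img i H : gsubset H K -> is_subgroup H ->
  forall y : Q, derived i (img H) y -> img (derived i H) y.
Proof.
move=> HK s; elim: i => [|i IH] y //=.
have dK : gsubset (derived i H) K by move=> z /(derived_sub s) /HK.
move=> hy; apply: gen_img.
  by move=> z [a [b [ha [hb ->]]]]; apply: subR => //; apply: dK.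
apply: gen_mono hy => z [a [b [/IH [a' [ha <-]] [/IH [b' [hb <-]] ->]]]].
exists (gcomm a' b'); split; last by rewrite homR //; apply: dK.
by exists a', b'.
Qed.

End Homs.

(* Q is the section K / N of G, with projection f (meaningful on K only). *)
Definition is_section (G Q : grp) (N K : G -> Prop) (f : G -> Q) :=
  [/\ is_subgroup K, is_subgroup N, gsubset N K &
   [/\ hom_on K f, (forall y, exists x, K x /\ f x = y) &
   (forall x, K x -> (f x = gone Q <-> N x))]].

Section SectionExists.
Variables (G : grp) (N K : G -> Prop).
Hypothesis nN : normal_in N K.
Let sN : is_subgroup N. Proof. by case: nN. Qed.
Let sK : is_subgroup K. Proof. by case: nN => _ []. Qed.
Let NK : gsubset N K. Proof. by case: nN => _ [_ []]. Qed.
Let nJ : forall h k, N h -> K k -> N (gconj h k). Proof. by case: nN => _ [_ []]. Qed.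

Let coset (x y : G) := K y /\ N (ginv x *g y).
(** [epsilon] depends only on the predicate, and equal cosets are equal predicates by
    extensionality; so the representative is canonical and the fixed points of [rep] can serve as
    the carrier of the quotient. *)
Let rep (x : G) : G := epsilon (inhabits (gone G)) (coset x).

Let rep_spec x : K x -> K (rep x) /\ N (ginv x *g rep x).
Proof.
move=> kx; apply: (@epsilon_spec _ (inhabits (gone G)) (coset x)); exists x; split=> //.
by rewrite gmulV; apply: sub1.
Qed.

Let rep_eq x y : K x -> K y -> N (ginv x *g y) -> rep x = rep y.
Proof.
move=> kx ky h; rewrite /rep; congr epsilon.
apply: functional_extensionality => z; apply: propositional_extensionality.
split=> [] [kz hz]; split=> //.
  have -> : ginv y *g z = ginv (ginv x *g y) *g (ginv x *g z) by gsolve.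
  by apply: subM => //; apply: subV.
have -> : ginv x *g z = (ginv x *g y) *g (ginv y *g z) by gsolve.
by apply: subM.
Qed.

Let rep_id x : K x -> rep (rep x) = rep x.
Proof.
move=> kx; have [kr hr] := rep_spec kx.
by symmetry; apply: rep_eq.
Qed.

Let T := {x : G | K x /\ rep x = x}.
Let T_inj (u v : T) : sval u = sval v -> u = v.
Proof. exact: eq_sig_hprop (fun _ => @proof_irrelevance _) _ _. Qed.
Let mk x (kx : K x) : T := exist _ (rep x) (conj (proj1 (rep_spec kx)) (rep_id kx)).
Let Tm (u v : T) : T := mk (subM sK (proj1 (svalP u)) (proj1 (svalP v))).
Let Ti (u : T) : T := mk (subV sK (proj1 (svalP u))).
Let T1 : T := mk (sub1 sK).

Let rep_mul x y : K x -> K y -> rep (rep x *g rep y) = rep (x *g y).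
Proof.
move=> kx ky; have [kx' hx] := rep_spec kx; have [ky' hy] := rep_spec ky.
symmetry; apply: rep_eq; [exact: subM | exact: subM|].
have -> : ginv (x *g y) *g (rep x *g rep y) =
  gconj (ginv x *g rep x) y *g (ginv y *g rep y) by gsolve.
by apply: subM => //; apply: nJ.
Qed.

Let repT (u : T) : rep (sval u) = sval u. Proof. by case: u => x []. Qed.
Let KT (u : T) : K (sval u). Proof. by case: u => x []. Qed.

Let TmA u v w : Tm u (Tm v w) = Tm (Tm u v) w.
Proof.
apply: T_inj => /=; rewrite -{1}(repT u) -{2}(repT w) !rep_mul ?gmulA //; exact: subM.
Qed.
Let Tm1 u : Tm T1 u = u.
Proof. by apply: T_inj => /=; rewrite -{1}(repT u) rep_mul ?gmul1 ?repT //; apply: sub1. Qed.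
Let TmV u : Tm (Ti u) u = T1.
Proof. by apply: T_inj => /=; rewrite -{2}(repT u) rep_mul ?gmulV //; apply: subV. Qed.

Lemma section_exists : exists (Q : grp) (f : G -> Q), is_section N K f.
Proof.
pose f x := if excluded_middle_informative (K x) is left kx then mk kx else T1.
have fE x : K x -> sval (f x) = rep x.
  by move=> kx; rewrite /f; case: excluded_middle_informative.
exists (Grp TmA Tm1 TmV), f; split=> //; split.
- move=> x y kx ky; apply: T_inj; rewrite /= !fE ?rep_mul //; exact: subM.
- by move=> u; exists (sval u); split=> //; apply: T_inj; rewrite fE.
move=> x kx; split=> [/(congr1 (@sval _ _))|h].
  rewrite fE //= => e; have [_ h1] := rep_spec (sub1 sK).
  have [_ h2] := rep_spec kx; rewrite e in h2.
  have -> : x = (ginv (gone G) *g rep (gone G)) *g ginv (ginv x *g rep (gone G)) by gsolve.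
  by apply: subM => //; apply: subV.
apply: T_inj; rewrite fE //=; symmetry; apply: rep_eq => //; first exact: sub1.
by rewrite ginv1 gmul1.
Qed.
End SectionExists.

Lemma quotient_exists (G : grp) (N : G -> Prop) : gnormal N ->
  exists (Q : grp) (f : G -> Q), is_section N (full G) f.
Proof. by move=> nN; apply: section_exists; apply: gnormal_inE. Qed.

Lemma subgrp_exists (G : grp) (K : G -> Prop) : is_subgroup K ->
  exists (Q : grp) (f : G -> Q), is_section (fun x => x = gone G) K f.
Proof.
move=> sK; apply: section_exists; split; first exact: sub_triv.
by split=> //; split=> [x ->|h k -> _]; [apply: sub1 | rewrite gconj1].
Qed.

Definition all_subnormal (n : nat) (G : grp) :=
  forall H : G -> Prop, is_subgroup H -> subnormal_le H n.

Definition engel (e : nat) (G : grp) :=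
  forall x g : G, iter e (fun y => gcomm y g) x = gone G.

(** These two consequences of bounded subnormality are all that the solubility argument uses; both
    pass to sections with the same [s] and [e]. *)
Definition good (s e : nat) (G : grp) :=
  (forall H : G -> Prop, is_subgroup H -> gsubset (derived s (ncl H)) H) /\ engel e G.

Section Sections.
Variables (G Q : grp) (N K : G -> Prop) (f : G -> Q).
Hypothesis sec : is_section N K f.
Let sK : is_subgroup K. Proof. by case: sec. Qed.
Let hf : hom_on K f. Proof. by case: sec => _ _ _ []. Qed.
Let surj : forall y, exists x, K x /\ f x = y. Proof. by case: sec => _ _ _ []. Qed.
Let ker : forall x, K x -> (f x = gone Q <-> N x). Proof. by case: sec => _ _ _ []. Qed.

Lemma section_eq x y : K x -> K y -> f x = f y -> N (ginv x *g y).
Proof.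
move=> kx ky e; apply/ker; first by apply: subM => //; apply: subV.
by rewrite hf ?(homV sK hf) ?e ?gmulV //; apply: subV.
Qed.

Lemma section_inj_preim (M : G -> Prop) x y : is_subgroup M -> gsubset N M ->
  K x -> K y -> f x = f y -> M x -> M y.
Proof.
move=> sM NM kx ky e mx; have := NM _ (section_eq kx ky e).
by move/(subM sM mx); rewrite gmulVKr.
Qed.

Lemma section_derived i x : derived i K x -> derived i (full Q) (f x).
Proof. by move=> h; apply: derived_mono (img_derived sK hf _ sK h). Qed.

Lemma derived_section i y : derived i (full Q) y -> exists x, derived i K x /\ f x = y.
Proof.
move=> h; apply: (derived_img sK hf (H := K)) => //.
by apply: derived_mono h => z _; apply: surj.
Qed.

Lemma section_soluble i : soluble_le (full Q) i <-> gsubset (derived i K) N.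
Proof.
split=> [h x dx|h y /derived_section [x [dx <-]]].
  by apply/ker; [apply: derived_sub dx | apply: h; apply: section_derived].
by apply/ker; [apply: derived_sub dx | apply: h].
Qed.

(** Intersecting the terms of a chain with [K] and projecting them gives a chain in [Q]; hence the
    given chains only have to end above [K], not at [G]. *)
Lemma section_all_subnormal m :
  (forall M, is_subgroup M -> gsubset N M -> gsubset M K ->
    exists c : nat -> G -> Prop, (forall x, c 0 x <-> M x) /\ gsubset K (c m) /\
      (forall i, i < m -> normal_in (c i) (c i.+1))) ->
  all_subnormal m Q.
Proof.
move=> h L sL.
have sM := sub_preim sK hf sL.
have [||c [c0 [cm cn]]] := h _ sM.
- move=> x nx; have kx : K x by case: sec => _ _ NK _; apply: NK.
  by split=> //; rewrite (proj2 (ker kx) nx); apply: sub1.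
- by move=> x [].
exists (fun i => img f (fun x => K x /\ c i x)); split=> [y|].
  split=> [[x [[kx /c0 [_ lx]] <-]] //|ly].
  have [x [kx e]] := surj y; exists x; split=> //; split=> //.
  by apply/c0; rewrite e.
split=> [y|i im].
  by have [x [kx e]] := surj y; exists x; split=> //; split=> //; apply: cm.
have [s1 [s2 [cc cJ]]] := cn i im.
split; first by apply: (sub_img sK hf) => [x []|]//; apply: subI.
split; first by apply: (sub_img sK hf) => [x []|]//; apply: subI.
split=> [_ [x [[kx cx] <-]]|_ _ [x [[kx cx] <-]] [y [[ky cy] <-]]].
  by exists x; split=> //; split=> //; apply: cc.
exists (gconj x y); split; last exact: (homJ sK hf).
by split; [apply: subJ | apply: cJ].
Qed.

Lemma section_iter_comm i x g : K x -> K g ->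
  K (iter i (fun y => gcomm y g) x) /\
  f (iter i (fun y => gcomm y g) x) = iter i (fun y => gcomm y (f g)) (f x).
Proof.
move=> kx kg; elim: i => //= i [k1 IH]; split; first exact: subR.
by rewrite (homR sK hf) // IH.
Qed.

Lemma section_engel e : engel e G -> engel e Q.
Proof.
move=> h y z; have [x [kx <-]] := surj y; have [g [kg <-]] := surj z.
by rewrite -(proj2 (section_iter_comm e kx kg)) h (hom1 sK hf).
Qed.

(** Conjugators in [Q] lift to [K], so the normal closure of [L] in [Q] lies in the image of the
    part of [ncl M] inside [K], where [M] is the preimage of [L]. *)
Lemma section_good s e : good s e G -> good s e Q.
Proof.
move=> [h1 h2]; split; last exact: section_engel.
move=> L sL y dy; set M := fun x => K x /\ L (f x).
have sM : is_subgroup M := sub_preim sK hf sL.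
have sI : is_subgroup (fun x => K x /\ ncl M x).
  by apply: subI => //; apply: gnormal_sub (gnormal_ncl M).
have /(derived_img sK hf (H := fun x => K x /\ ncl M x)) :
    derived s (img f (fun x => K x /\ ncl M x)) y.
  apply: derived_mono dy; apply: gen_min.
    by apply: (sub_img sK hf) => // x [].
  move=> _ [a [g [la ->]]].
  have [x [kx ex]] := surj a; have [k [kk ek]] := surj g.
  exists (gconj x k); split; last by rewrite (homJ sK hf) // ex ek.
  split; first exact: subJ.
  by apply: (gnormalJ _ (gnormal_ncl M)); apply: ncl_sub; split; rewrite ?ex.
case=> // [x []|x [dx <-]] //.
have /h1 : derived s (ncl M) x by apply: derived_mono dx => z [].
by case.
Qed.

Lemma section_gen l : (forall x, List.In x l -> K x) -> gsubset K (glist l) ->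
  forall y, glist (map f l) y.
Proof.
move=> lK Kl y; have [x [/Kl h <-]] := surj y.
apply: gen_mono (img_gen sK hf lK h) => _ [z [hz <-]]; exact: List.in_map.
Qed.

End Sections.

(** * Normal closure series and the Engel condition *)

Section ClosureSeries.
Variables (G : grp) (H : G -> Prop).

Fixpoint ncs (i : nat) : G -> Prop :=
  if i is j.+1 then gen (fun z => exists h k, H h /\ ncs j k /\ z = gconj h k)
  else full G.

Lemma sub_ncs i : is_subgroup (ncs i).
Proof. by case: i => [|i]; [apply: sub_full | apply: sub_gen]. Qed.

Lemma ncs_ge i : gsubset H (ncs i).
Proof.
case: i => [|i] x hx //; apply: gen_in; exists x, (gone G).
by rewrite gconjg1; split=> //; split=> //; apply: sub1; apply: sub_ncs.
Qed.

Lemma ncs_normal i : normal_in (ncs i.+1) (ncs i).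
Proof.
split; first exact: sub_ncs.
split; first exact: sub_ncs.
split.
  apply: gen_min; first exact: sub_ncs.
  by move=> z [h [k [hh [hk ->]]]]; apply: subJ => //; [apply: sub_ncs | apply: ncs_ge].
move=> x k hx hk; apply: gen_conj hx => _ [h [k' [hh [hk' ->]]]].
exists h, (k' *g k); rewrite gconjJ; split=> //; split=> //.
by apply: subM => //; apply: sub_ncs.
Qed.

Lemma ncs_le i j : i <= j -> gsubset (ncs j) (ncs i).
Proof.
move/subnK <-; elim: (j - i) => //= m IH x hx.
by apply: IH; case: (ncs_normal (m + i)) => _ [_ [h _]]; apply: h.
Qed.

(** The closure series descends at least as fast as any chain: [c (n - j.+1)] contains [H] and is
    normal in [c (n - j)], so it absorbs the conjugates that generate the next closure. *)
Lemma ncs_chain n (c : nat -> G -> Prop) :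
  (forall x, c 0 x <-> H x) -> (forall x, c n x) ->
  (forall i, i < n -> normal_in (c i) (c i.+1)) ->
  forall j, j <= n -> gsubset (ncs j) (c (n - j)).
Proof.
move=> c0 cn cN.
have Hc i : i <= n -> gsubset H (c i).
  elim: i => [_ x hx|i IH ltin x hx]; first exact/c0.
  by case: (cN i ltin) => _ [_ [h _]]; apply: h; apply: IH (ltnW ltin) _ hx.
elim=> [_ x _|j IH ltjn]; first by rewrite subn0.
have lt : n - j.+1 < n by rewrite ltn_subrL (leq_ltn_trans _ ltjn).
have := cN _ lt; rewrite -subSn // subSS => -[s1 [s2 [_ cJ]]].
apply: gen_min => // _ [h [k [hh [hk ->]]]].
by apply: cJ; [apply: Hc (ltnW lt) _ hh | apply: IH (ltnW ltjn) _ hk].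
Qed.

(** The start [i0] is 1 when nothing is known about the top factor, and 0 when all factors are
    controlled. *)
Lemma ncs_derived n t i0 : subnormal_le H n -> i0 <= n ->
  (forall i, i0 <= i < n -> gsubset (derived t (ncs i)) (ncs i.+1)) ->
  gsubset (derived ((n - i0) * t) (ncs i0)) H.
Proof.
move=> [c [c0 [cn cN]]] le h.
have step m : i0 + m <= n -> gsubset (derived (m * t) (ncs i0)) (ncs (i0 + m)).
  elim: m => [|m IH] lem; first by rewrite addn0.
  rewrite addnS in lem *.
  move=> x; rewrite mulSn derivedD => hx.
  apply: (h (i0 + m)); first by rewrite leq_addr.
  by apply: derived_mono hx; apply: IH; apply: ltnW.
move=> x /(step (n - i0)); rewrite subnKC // => /(_ (leqnn _)) hx.
by have := ncs_chain c0 cn cN (leqnn n) hx; rewrite subnn => /c0.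
Qed.

End ClosureSeries.

(** Take a chain from the cyclic group of [g] up to [G]. Each commutation with [g] descends one
    term, as [[y, g]] is a conjugate of [ginv g] times [g]. After [n] steps the result is a power of
    [g], and one more commutator vanishes. *)
Lemma all_subnormal_engel n G : all_subnormal n G -> engel n.+1 G.
Proof.
move=> h x g.
have [c [c0 [cn cN]]] := h _ (sub_gen (fun y => y = g)).
have gc i : i <= n -> c i g.
  elim: i => [_|i IH ltin]; first by apply/c0; apply: gen_in.
  by case: (cN i ltin) => _ [_ [hh _]]; apply: hh; apply: IH; apply: ltnW.
have step j : j <= n -> c (n - j) (iter j (fun y => gcomm y g) x).
  elim: j => [|j IH] ltjn; first by rewrite subn0.
  have lt : n - j.+1 < n by rewrite ltn_subrL (leq_ltn_trans _ ltjn).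
  have := cN _ lt; rewrite -subSn // subSS => -[s1 [s2 [_ cJ]]] /=.
  set y := iter j _ x.
  have -> : gcomm y g = gconj (ginv g) y *g g by gsolve.
  have cg := gc _ (ltnW lt).
  by apply: subM => //; apply: cJ; [apply: subV | apply: IH; apply: ltnW].
have := step n (leqnn n); rewrite subnn => /c0 hy /=.
apply/gcomm_eq1; have sC : is_subgroup (fun y => y *g g = g *g y).
  split; first by gnorm.
  split=> [y z ey ez|y ey].
    by rewrite -gmulA ez gmulA ey gmulA.
  by apply: (@gmul_injl _ y); rewrite gmulVKr gmulA ey; gsolve.
by apply: (gen_min sC _ hy) => y ->.
Qed.

Definition solubility_bound (n t : nat) :=
  forall G, all_subnormal n G -> soluble_le (full G) t.

(** For [i >= 1], a subgroup between [ncs H i.+1] and [ncs H i] contains [H]. The last proper term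
    [c n] of its chain is normal in [G], so it contains the normal closure of [H] and with it
    [ncs H i]. This saves one step: the defect inside the factor is at most [n], and the bound for
    [n] applies to each of the [n] factors below [ncs H 1]. *)
Lemma all_subnormal_good n t G : solubility_bound n t -> all_subnormal n.+1 G ->
  good (n * t) n.+2 G.
Proof.
move=> hb hG; split; last exact: all_subnormal_engel.
move=> H sH x hx.
have : derived ((n.+1 - 1) * t) (ncs H 1) x.
  rewrite subSS subn0; apply: derived_mono hx; apply: gen_mono.
  by move=> z [a [g [ha ->]]]; exists a, g.
apply: ncs_derived => //; first exact: hG.
move=> i /andP[i1 ltin].
have [Q [f sec]] := section_exists (ncs_normal H i).
apply/(section_soluble sec); apply: hb.
apply: (section_all_subnormal sec) => M sM NM MK.
have [c [c0 [cn cN]]] := hG M sM.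
exists c; split=> //; split=> [y hy|j ltjn]; last by apply: cN; apply: ltnW.
have [s1 [_ [_ cJ]]] := cN n (ltnSn n).
have Mc j : j <= n -> gsubset M (c j).
  elim: j => [_ z hz|j IH ltj z hz]; first exact/c0.
  by case: (cN j (ltnW ltj)) => _ [_ [hh _]]; apply: hh; apply: IH (ltnW ltj) _ hz.
have : ncs H 1 y by apply: ncs_le hy.
apply: gen_min => // _ [h [k [hh [_ ->]]]].
apply: cJ => //; apply: Mc => //; apply: NM.
exact: ncs_ge.
Qed.

(** * Powers and relative central series *)

Lemma pred_ext (T : Type) (P Q : T -> Prop) : (forall x, P x <-> Q x) -> P = Q.
Proof.
by move=> h; apply: functional_extensionality => x; apply: propositional_extensionality.
Qed.

Section Powers.
Variable G : grp.
Implicit Types (x y z : G) (H P : G -> Prop).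

Definition zp x (k : Z) : G :=
  match k with
  | Z0 => gone G
  | Zpos p => iter (Pos.to_nat p) (gmul x) (gone G)
  | Zneg p => ginv (iter (Pos.to_nat p) (gmul x) (gone G))
  end.

Lemma zp_nat x n : zp x (Z.of_nat n) = iter n (gmul x) (gone G).
Proof. by case: n => [|n] //; rewrite /zp /= SuccNat2Pos.id_succ. Qed.

Lemma iter_mul_comm x n : x *g iter n (gmul x) (gone G) = iter n (gmul x) (gone G) *g x.
Proof. by elim: n => /= [|n IH]; [gsolve | rewrite {1}IH gmulA]. Qed.

Lemma zp_neg_nat x n : zp x (- Z.of_nat n) = ginv (iter n (gmul x) (gone G)).
Proof. by case: n => [|n]; [rewrite /= ginv1 | rewrite /zp /= SuccNat2Pos.id_succ]. Qed.

Lemma zpS x k : zp x (k + 1)%Z = zp x k *g x.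
Proof.
have [h|h] : (0 <= k)%Z \/ (k < 0)%Z by lia.
  have -> : (k + 1)%Z = Z.of_nat (Z.to_nat k).+1 by lia.
  by rewrite -{2}(Z2Nat.id k h) !zp_nat /= iter_mul_comm.
have -> : (k + 1)%Z = (- Z.of_nat (Z.to_nat (- k - 1)))%Z by lia.
have e : k = (- Z.of_nat (Z.to_nat (- k - 1)).+1)%Z by lia.
by rewrite [in RHS]e !zp_neg_nat /= ginvM -gmulA gmulV gmul1r.
Qed.

Lemma zp1 x : zp x 1 = x. Proof. by rewrite (zpS x 0) gmul1. Qed.

(** The step is an equivalence so that it runs in both directions; cancellation usually supplies the
    backward half. *)
Lemma zp_ind (P : Z -> Prop) : P 0%Z -> (forall k, P k <-> P (k + 1)%Z) -> forall k, P k.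
Proof.
by move=> h0 hS; apply: (Z.bi_induction P) => // n; rewrite -Z.add_1_r.
Qed.

Lemma zpD x j k : zp x (j + k)%Z = zp x j *g zp x k.
Proof.
elim/zp_ind: k => [|k]; first by rewrite Z.add_0_r gmul1r.
by rewrite Z.add_assoc !zpS gmulA; split=> [->//|]; apply: gmul_injr.
Qed.

Lemma zpN x k : zp x (- k)%Z = ginv (zp x k).
Proof.
by apply: (@gmul_injl _ (zp x k)); rewrite -zpD gmulVr Z.add_opp_diag_r.
Qed.

Lemma zpN1 x : zp x (-1) = ginv x.
Proof. by rewrite (zpN x 1) zp1. Qed.

Lemma zpM x j k : zp x (j * k)%Z = zp (zp x j) k.
Proof.
elim/zp_ind: k => [|k]; first by rewrite Z.mul_0_r.
by rewrite Z.mul_add_distr_l Z.mul_1_r zpD zpS; split=> [->//|]; apply: gmul_injr.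
Qed.

Lemma zp_one k : zp (gone G) k = gone G.
Proof.
elim/zp_ind: k => // k; rewrite zpS gmul1r; exact: iff_refl.
Qed.

Lemma sub_zp H x k : is_subgroup H -> H x -> H (zp x k).
Proof.
move=> s hx; elim/zp_ind: k => [|k]; first exact: sub1.
by rewrite zpS; symmetry; apply: subMr.
Qed.

Lemma zp_mulC x y k : x *g y = y *g x -> zp (x *g y) k = zp x k *g zp y k.
Proof.
move=> e; elim/zp_ind: k => [|k]; first by rewrite gmul1.
have c : zp y k *g x = x *g zp y k.
  have sC : is_subgroup (fun z => z *g x = x *g z).
    split; first by gnorm.
    split=> [a b ea eb|a ea]; first by rewrite -gmulA eb gmulA ea gmulA.
    by apply: (@gmul_injl _ a); rewrite gmulVKr gmulA ea; gsolve.
  exact: (sub_zp k sC (esym e)).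
have e2 : zp x k *g x *g (zp y k *g y) = zp x k *g zp y k *g (x *g y).
  by rewrite -!gmulA (gmulA x (zp y k)) -c !gmulA.
by rewrite !zpS e2; split=> [->//|]; apply: gmul_injr.
Qed.

Lemma zp_conj x g k : gconj (zp x k) g = zp (gconj x g) k.
Proof.
elim/zp_ind: k => [|k]; first by rewrite gconj1.
by rewrite !zpS gconjM; split=> [->//|]; apply: gmul_injr.
Qed.

(** Invariance under [z] and under [ginv z] are separate conditions, as conjugation may map an
    infinite subgroup properly into itself. *)
Lemma zp_conj_inv P z k : (forall p, P p -> P (gconj p z)) ->
  (forall p, P p -> P (gconj p (ginv z))) -> forall p, P p -> P (gconj p (zp z k)).
Proof.
move=> h1 h2; elim/zp_ind: k => [|k]; first by move=> p; rewrite gconjg1.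
rewrite zpS; split=> h p hp; first by rewrite -gconjJ; apply/h1/h.
by rewrite -(gconjK (gconj p (zp z k)) z); apply: h2; rewrite gconjJ; apply: h.
Qed.

Lemma coset_form P z : is_subgroup P -> (forall p, P p -> P (gconj p z)) ->
  (forall p, P p -> P (gconj p (ginv z))) ->
  forall x, gen (fun y => P y \/ y = z) x <-> exists p k, P p /\ x = p *g zp z k.
Proof.
move=> sP h1 h2 x; split; last first.
  move=> [p [k [hp ->]]]; apply: gen_mul; first by apply: gen_in; left.
  by apply: sub_zp; [apply: sub_gen | apply: gen_in; right].
have sC : is_subgroup (fun x => exists p k, P p /\ x = p *g zp z k).
  split; first by exists (gone G), 0%Z; split; [apply: sub1 | rewrite gmul1].
  split=> [_ _ [p [k [hp ->]]] [q [j [hq ->]]]|_ [p [k [hp ->]]]].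
    exists (p *g gconj q (zp z (- k))), (k + j)%Z; split.
      by apply: subM => //; apply: zp_conj_inv.
    by rewrite zpD zpN; gsolve.
  exists (gconj (ginv p) (zp z k)), (- k)%Z; split.
    by apply: zp_conj_inv => //; apply: subV.
  by rewrite zpN; gsolve.
apply: (gen_min sC) => y [hy|->].
  by exists y, 0%Z; rewrite gmul1r.
by exists (gone G), 1%Z; rewrite zp1 gmul1; split=> //; apply: sub1.
Qed.

Lemma coset_zp P z p j k : is_subgroup P -> (forall p, P p -> P (gconj p z)) ->
  (forall p, P p -> P (gconj p (ginv z))) -> P p ->
  exists q, P q /\ zp (p *g zp z j) k = q *g zp z (j * k)%Z.
Proof.
move=> sP h1 h2 hp; elim/zp_ind: k => [|k].
  by exists (gone G); rewrite Z.mul_0_r gmul1; split=> //; apply: sub1.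
rewrite zpS Z.mul_add_distr_l Z.mul_1_r zpD; split=> [[q [hq e]]|[q [hq e]]].
  exists (q *g gconj p (zp z (- (j * k)))); split.
    by apply: subM => //; apply: zp_conj_inv.
  by rewrite e zpN; gsolve.
exists (q *g ginv (gconj p (zp z (- (j * k))))); split.
  by apply: subM => //; apply: subV => //; apply: zp_conj_inv.
apply: (@gmul_injr _ (p *g zp z j)); rewrite e zpN; gsolve.
Qed.

End Powers.

Lemma Zsub_cyclic (J : Z -> Prop) : J 0%Z -> (forall i j, J i -> J j -> J (i - j)%Z) ->
  exists d, J d /\ forall j, J j -> (d | j)%Z.
Proof.
move=> J0 JB.
have JN j : J j -> J (- j)%Z by move=> h; apply: (JB 0%Z j).
have JD i j : J i -> J j -> J (i + j)%Z.
  by move=> hi hj; have := JB _ _ hi (JN _ hj); rewrite Z.sub_opp_r.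
have JM m j : J j -> J (m * j)%Z.
  move=> hj; elim/zp_ind: m => // m; rewrite Z.mul_add_distr_r Z.mul_1_l.
  by split=> [h|/JB /(_ hj)]; [apply: JD | rewrite Z.add_simpl_r].
case: (classic (exists n : nat, J (Z.of_nat n.+1))) => [ex|nex]; last first.
  exists 0%Z; split=> // j hj.
  have [->|h] : j = 0%Z \/ j <> 0%Z by lia.
    exact: Z.divide_refl.
  case: nex; exists (Z.to_nat (Z.abs j - 1)).
  have -> : Z.of_nat (Z.to_nat (Z.abs j - 1)).+1 = Z.abs j by lia.
  have [->|->] : Z.abs j = j \/ Z.abs j = (- j)%Z by lia.
    exact: hj.
  exact: JN.
have [n [hn min]] : exists n : nat, J (Z.of_nat n.+1) /\
    forall m : nat, J (Z.of_nat m.+1) -> (n <= m)%N.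
  case: ex => n; elim/ltn_ind: n => n IH hn.
  case: (classic (exists m : nat, (m < n)%N /\ J (Z.of_nat m.+1))) => [[m [lt hm]]|h].
    exact: IH lt hm.
  exists n; split=> // m hm; rewrite leqNgt; apply/negP => lt; apply: h.
  by exists m.
exists (Z.of_nat n.+1); split=> // j hj.
have npos : (0 < Z.of_nat n.+1)%Z by lia.
have [b1 b2] := Z.mod_pos_bound j _ npos.
have jm : J (j mod Z.of_nat n.+1)%Z.
  rewrite Z.mod_eq; last by lia.
  by apply: JB => //; rewrite Z.mul_comm; apply: JM.
have nz : Z.of_nat n.+1 <> 0%Z by lia.
apply: (proj1 (Z.mod_divide j _ nz)).
have [//|h] : (j mod Z.of_nat n.+1 = 0)%Z \/ (j mod Z.of_nat n.+1 <> 0)%Z by lia.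
exfalso; set a := (j mod _)%Z in b1 b2 jm h.
have := min (Z.to_nat (a - 1)).
have -> : Z.of_nat (Z.to_nat (a - 1)).+1 = a by lia.
move=> /(_ jm); lia.
Qed.

(** The exponents [j] for which the coset of [zp z j] modulo [P] meets [K] form a subgroup of Z,
    generated by some [d]; [w] is an element of [K] in the coset of [zp z d]. Thus each cyclic step
    costs a subgroup at most one generator. *)
Lemma cyclic_ext_subgroup (G : grp) (P K : G -> Prop) z :
  is_subgroup P -> (forall p, P p -> P (gconj p z)) ->
  (forall p, P p -> P (gconj p (ginv z))) -> is_subgroup K ->
  gsubset K (gen (fun y => P y \/ y = z)) ->
  exists w, K w /\ forall x, K x -> gen (fun y => (K y /\ P y) \/ y = w) x.
Proof.
move=> sP h1 h2 sK KP.
have [||d [[p [hp kw]] dJ]] := @Zsub_cyclic (fun j => exists p, P p /\ K (p *g zp z j)).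
- by exists (gone G); rewrite gmul1; split; apply: sub1.
- move=> i j [p [hp kp]] [q [hq kq]].
  have : K ((p *g zp z i) *g ginv (q *g zp z j)) by apply: subM => //; apply: subV.
  have -> : (p *g zp z i) *g ginv (q *g zp z j) =
     (p *g gconj (ginv q) (zp z (- (i - j))))  *g zp z (i - j).
    by rewrite /Z.sub zpN zpD zpN; gsolve.
  move=> h; exists (p *g gconj (ginv q) (zp z (- (i - j)))); split=> //.
  by apply: subM => //; apply: zp_conj_inv => //; apply: subV.
exists (p *g zp z d); split=> // x kx.
have [q [k [hq e]]] := proj1 (coset_form sP h1 h2 x) (KP _ kx).
have [|m km] := dJ k; first by exists q; rewrite -e.
have [q' [hq' e']] := coset_zp d m sP h1 h2 hp.
set w := p *g zp z d in kw e' *.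
have -> : x = (x *g ginv (zp w m)) *g zp w m by gsolve.
apply: gen_mul; last by apply: sub_zp; [apply: sub_gen | apply: gen_in; right].
apply: gen_in; left; split.
  by apply: subM => //; apply: subV => //; apply: sub_zp.
have -> : x *g ginv (zp w m) = q *g ginv q'.
  by rewrite e e' km Z.mul_comm; gsolve.
by apply: subM => //; apply: subV.
Qed.

Section RelativeCentralSeries.
Variable G : grp.
Implicit Types (A B P S : G -> Prop) (x y g : G).
Notation triv := (fun x : G => x = gone G).

(* x lies in cs B S i iff all commutators [x, g_1, ..., g_i] with g_j in S lie in B;
   thus cs 1 G i is the i-th term of the upper central series. *)
Fixpoint cs B S i x : Prop :=
  if i is j.+1 then forall g, S g -> cs B S j (gcomm x g) else B x.

Lemma cs_mono B B' S S' i x : gsubset B B' -> gsubset S' S -> cs B S i x -> cs B' S' i x.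
Proof.
move=> BB SS; elim: i x => /= [x /BB //|i IH x h g /SS hg].
by apply: IH; apply: h.
Qed.

Lemma cs_one B S i : is_subgroup B -> cs B S i (gone G).
Proof. by move=> sB; elim: i => /= [|i IH g _]; [apply: sub1 | rewrite gcomm1]. Qed.

Lemma csS S i x : cs triv S i x -> cs triv S i.+1 x.
Proof.
elim: i x => [x -> g _|i IH x h g hg]; first exact: gcomm1.
by apply: IH; apply: h.
Qed.

Lemma cs_le S i j x : i <= j -> cs triv S i x -> cs triv S j x.
Proof.
by move/subnK <-; elim: (j - i) => // m IH h; rewrite addSn; apply/csS/IH.
Qed.

Definition abel A := forall a b, A a -> A b -> a *g b = b *g a.

Section OnAbelian.
Variable A : G -> Prop.
Hypotheses (nA : gnormal A) (aA : abel A).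
Let sA := gnormal_sub nA.

Lemma abel_conj a b : A a -> A b -> gconj a b = a.
Proof. by move=> ha hb; rewrite /gconj (aA ha hb) gmulKr. Qed.

Lemma abel_commM a b g : A a -> A b -> gcomm (a *g b) g = gcomm a g *g gcomm b g.
Proof.
move=> ha hb; have -> : gcomm (a *g b) g = gconj (gcomm a g) b *g gcomm b g by gsolve.
by rewrite abel_conj //; apply: gnormalRl.
Qed.

Lemma abel_commV a g : A a -> gcomm (ginv a) g = ginv (gcomm a g).
Proof.
move=> ha; have -> : gcomm (ginv a) g = gconj (ginv (gcomm a g)) (ginv a) by gsolve.
by rewrite abel_conj //; [apply: subV => //; apply: gnormalRl | apply: subV].
Qed.

Lemma cs_sub B S i : is_subgroup B -> is_subgroup (fun a => A a /\ cs B S i a).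
Proof.
move=> sB; split; first by split; [apply: sub1 | apply: cs_one].
split=> [x y [ax cx] [ay cy]|x [ax cx]].
  split; first exact: subM.
  elim: i x y ax ay cx cy => [|i IH] x y ax ay cx cy; first exact: subM.
  move=> g hg; rewrite abel_commM //.
  by apply: IH; [apply: gnormalRl | apply: gnormalRl | apply: cx | apply: cy].
split; first exact: subV.
elim: i x ax cx => [|i IH] x ax cx; first exact: subV.
move=> g hg; rewrite abel_commV //.
by apply: IH; [apply: gnormalRl | apply: cx].
Qed.

Lemma csM B S i x y : is_subgroup B -> A x -> A y -> cs B S i x -> cs B S i y ->
  cs B S i (x *g y).
Proof.
by move=> sB ax ay cx cy; case: (@subM _ _ x y (cs_sub S i sB)).
Qed.

Lemma csV B S i x : is_subgroup B -> A x -> cs B S i x -> cs B S i (ginv x).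
Proof. by move=> sB ax cx; case: (@subV _ _ x (cs_sub S i sB)). Qed.

(** For a product, [[a, xy] = [a, y] [a, x] [[a, x], y]], whose last factor lies even deeper. For an
    inverse, put [b = [a, x]]; then [[a, x^-1]] is the inverse of [b [b, x^-1]], and [b] sits one
    level lower, whence the induction on [i]. *)
Lemma cs_gen_step S g : gen S g ->
  forall i a, A a -> cs triv S i.+1 a -> cs triv S i (gcomm a g).
Proof.
have sT := @sub_triv G.
elim=> [x hx i a ha h|i a _ _|x y _ IHx _ IHy i a ha h|x _ IH i].
- exact: h.
- by have -> : gcomm a (gone G) = gone G; [gsolve | apply: cs_one].
- have -> : gcomm a (x *g y) = gcomm a y *g (gcomm a x *g gcomm (gcomm a x) y) by gsolve.
  have ax := gnormalRl x nA ha.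
  have axy := gnormalRl y nA ax.
  apply: csM => //; [exact: gnormalRl | exact: subM | exact: IHy |].
  apply: csM => //; first exact: IHx.
  case: i h => [|i] h; first by rewrite /= (IHx 0 a ha h) gcomm1.
  by apply: csS; apply: IHy => //; apply: IHx.
elim: i => [|i IHi] a ha h; set b := gcomm a x;
  have -> : gcomm a (ginv x) = ginv (b *g gcomm b (ginv x)) by rewrite /b; gsolve.
- by rewrite /= /b (IH 0 a ha h) gcomm1; gsolve.
have ab : A b by apply: gnormalRl.
have abx : A (gcomm b (ginv x)) by apply: gnormalRl.
apply: csV => //; first exact: subM.
have cb : cs triv S i.+1 b by apply: IH.
by apply: csM => //; apply: csS; apply: IHi.
Qed.

Lemma cs_gen S i a : A a -> cs triv S i a -> cs triv (gen S) i a.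
Proof.
elim: i a => // i IH a ha h g hg.
by apply: IH; [apply: gnormalRl | apply: cs_gen_step].
Qed.

Lemma cs_conj P i y a : (forall p, P p -> P (gconj p (ginv y))) ->
  cs triv P i a -> cs triv P i (gconj a y).
Proof.
move=> hP; suff: forall B, gsubset B (fun x => B (gconj x y)) ->
  cs B P i a -> cs B P i (gconj a y) by apply=> x ->; apply: gconj1.
move=> B hB; elim: i a => [a|i IH a h p hp]; first exact: hB.
have -> : gcomm (gconj a y) p = gconj (gcomm a (gconj p (ginv y))) y by gsolve.
by apply: IH; apply: h; apply: hP.
Qed.

(** Among the first [e] entries of a commutator word, either all are [y], and the Engel condition
    kills it, or one lies in [P], and the level [i] drops by one. The levels are invariant under [y]
    because [y] normalises [P], so each level costs at most [e] entries. *)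
Lemma cs_cyclic_ext e P y i a : (forall p, P p -> P (gconj p (ginv y))) ->
  (forall a, A a -> iter e (fun x => gcomm x y) a = gone G) ->
  A a -> cs triv P i a -> cs triv (fun x => P x \/ x = y) (i * e) a.
Proof.
have sT := @sub_triv G.
move=> hP hy; elim: i a => [|i IHi] a ha h; first exact: h.
have cl b : A b -> cs triv P i.+1 b -> cs triv P i.+1 (gcomm b y).
  move=> ab cb; apply: (@csM triv P i.+1) => //; first exact: subV.
  - exact: gnormalJ.
  - exact: csV.
  - exact: cs_conj.
have: iter e (fun x => gcomm x y) a = gone G by apply: hy.
rewrite mulSn; move: {1 2}e => j.
elim: j a ha h => [|j IHj] a ha h; first by move=> /= ->; apply: cs_one.
rewrite iterSr addSn => ej g [hg|->]; last first.
  by apply: IHj => //; [apply: gnormalRl | apply: cl].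
apply: (@cs_le _ (i * e)); first exact: leq_addl.
by apply: IHi; [apply: gnormalRl | apply: h].
Qed.

End OnAbelian.

(* pc B m P: P is obtained from B by m successive extensions with cyclic quotient. *)
Inductive pc B : nat -> (G -> Prop) -> Prop :=
| pc0 : pc B 0 B
| pcS m P z : pc B m P -> (forall p, P p -> P (gconj p z)) ->
    (forall p, P p -> P (gconj p (ginv z))) ->
    pc B m.+1 (gen (fun x => P x \/ x = z)).

Lemma pc_trans B m m' P P' : pc B m P -> pc P m' P' -> pc B (m' + m) P'.
Proof. by move=> h; elim=> // {}m' {}P' z _ IH h1 h2; rewrite addSn; apply: pcS. Qed.

Lemma pc_sub B m P : is_subgroup B -> pc B m P -> is_subgroup P.
Proof. by move=> sB; case=> // {}m {}P z _ _ _; apply: sub_gen. Qed.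

Lemma pc_act A e B m P M : gnormal A -> abel A -> engel e G -> pc B m P ->
  (forall a, A a -> cs triv B M a) -> forall a, A a -> cs triv P (M * e ^ m) a.
Proof.
move=> nA aA en; elim=> [|{}m {}P z _ IH h1 h2] h a ha.
  by rewrite expn0 muln1; apply: h.
apply: (cs_gen nA aA) => //; rewrite expnSr mulnA.
by apply: (cs_cyclic_ext nA aA) => //; apply: IH.
Qed.

Lemma pc_subgroup_gen B m P : is_subgroup B -> gsubset B triv -> pc B m P ->
  forall K, is_subgroup K -> gsubset K P ->
  exists l, size l = m /\ (forall x, K x <-> glist l x).
Proof.
move=> sB Bt; elim=> [|{}m {}P z hpc IH h1 h2] K sK KP.
  exists nil; split=> // x; split=> [/KP /Bt ->|]; first exact: gen_one.
  by apply: gen_min => //.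
have sP := pc_sub sB hpc.
have [w [kw hw]] := cyclic_ext_subgroup sP h1 h2 sK KP.
have [|x []//|l [sl hl]] := IH (fun x => K x /\ P x); first exact: subI.
exists (w :: l); rewrite /= sl; split=> // x; split=> [/hw|].
  apply: gen_min; first exact: sub_gen.
  move=> y [/hl|->]; last by apply: gen_in; left.
  by apply: gen_mono => t ht; right.
apply: gen_min => // y [<- //|hy].
by have /hl [] : glist l y by apply: gen_in.
Qed.

(** The lower central series with the index starting at 0: [lcn i] is usually written with subscript
    [i + 1]. *)
Fixpoint lcn i : G -> Prop :=
  if i is j.+1 then gen (fun z => exists u g, lcn j u /\ z = gcomm u g) else full G.

Lemma gnormal_lcn i : gnormal (lcn i).
Proof.
elim: i => [|i IH] /=; first exact: gnormal_full.
apply: gnormal_gen => _ h [u [g [hu ->]]].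
by exists (gconj u h), (gconj g h); rewrite gconjR; split=> //; apply: gnormalJ.
Qed.

Lemma lcnS i : gsubset (lcn i.+1) (lcn i).
Proof.
apply: gen_min; first exact: gnormal_sub (gnormal_lcn i).
by move=> _ [u [g [hu ->]]]; apply: (gnormalRl _ (gnormal_lcn i)).
Qed.

Lemma lcnR i u g : lcn i u -> lcn i.+1 (gcomm u g).
Proof. by move=> h; apply: gen_in; exists u, g. Qed.

(** The left-normed commutators of weight [w.+1] in the entries of [l]; they generate [lcn w] modulo
    [lcn w.+1] when [l] generates the group. *)
Fixpoint lcl (l : seq G) w : seq G :=
  if w is v.+1 then List.map (fun p => gcomm p.1 p.2) (List.list_prod (lcl l v) l) else l.

Lemma size_lcl l w : size (lcl l w) = size l ^ w.+1.
Proof.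
elim: w => [|w IH] /=; first by rewrite expn1.
have -> : forall T (s : seq T), size s = List.length s by [].
rewrite List.length_map List.length_prod -[List.length (lcl l w)]/(size (lcl l w)) IH.
by rewrite [RHS]expnSr.
Qed.

Lemma lcl_lcn l w x : List.In x (lcl l w) -> lcn w x.
Proof.
elim: w x => //= w IH x /List.in_map_iff [[u g] [<- /List.in_prod_iff [hu hg]]].
by apply: lcnR; apply: IH.
Qed.

(** The factor of [lcn w] by [lcn w.+1] is central, so every subgroup between the two is normal. *)
Lemma gnormal_lcn_ext w S : gsubset S (lcn w) ->
  gnormal (gen (fun x => lcn w.+1 x \/ S x)).
Proof.
move=> h; split; first exact: sub_gen.
have le : gsubset (gen (fun x => lcn w.+1 x \/ S x)) (lcn w).
  apply: gen_min; first exact: gnormal_sub (gnormal_lcn w).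
  by move=> x [/lcnS|/h].
move=> x g hx _; rewrite gconjE; apply: gen_mul => //.
by apply: gen_in; left; apply: lcnR; apply: le.
Qed.

Lemma lcn_gen l w : (forall x, glist l x) ->
  gsubset (lcn w) (gen (fun x => lcn w.+1 x \/ List.In x (lcl l w))).
Proof.
move=> hl; elim: w => [|w IH].
  by move=> x _; apply: gen_mono (hl x) => y hy; right.
set T := gen _.
have nT : gnormal T by apply: gnormal_lcn_ext => x; apply: lcl_lcn.
apply: gen_min; first exact: gnormal_sub nT.
move=> _ [u [g [/IH hu ->]]].
apply: (comm_gen nT _ hu (hl g)) => a b [ha|ha] hb; apply: gen_in.
  by left; apply: lcnR.
right; apply/List.in_map_iff; exists (a, b); split=> //.
exact/List.in_prod_iff.
Qed.

Lemma pc_lcn_list w s : (forall x, List.In x s -> lcn w x) ->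
  pc (lcn w.+1) (size s) (gen (fun x => lcn w.+1 x \/ List.In x s)).
Proof.
elim: s => [|z s IH] h.
  have -> : gen (fun x => lcn w.+1 x \/ List.In x [::]) = lcn w.+1; last exact: pc0.
  apply: pred_ext => x; split=> [|hx]; last by apply: gen_in; left.
  by apply: gen_min => [|y []//]; apply: gnormal_sub (gnormal_lcn _).
have h' x : List.In x s -> lcn w x by move=> hx; apply: h; right.
have nT := gnormal_lcn_ext h'.
have -> : gen (fun x => lcn w.+1 x \/ List.In x (z :: s)) =
    gen (fun x => gen (fun x => lcn w.+1 x \/ List.In x s) x \/ x = z).
  apply: pred_ext => x; split; apply: gen_min; try exact: sub_gen.
  - move=> y [hy|[<-|hy]]; apply: gen_in; [left|by right|left]; apply: gen_in.
      by left.
    by right.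
  - move=> y [|->]; last by apply: gen_in; right; left.
    by apply: gen_mono => t [ht|ht]; [left | right; right].
by apply: pcS; [apply: IH | move=> p; apply: gnormalJ | move=> p; apply: gnormalJ].
Qed.

(** This is [k + k^2 + ... + k^w], one cyclic step for each left-normed commutator of weight at most
    [w] in [k] generators. *)
Fixpoint plen k w := if w is v.+1 then plen k v + k ^ w else 0.

Lemma pc_lcn l k w : size l = k -> (forall x, glist l x) -> pc (lcn w) (plen k w) (full G).
Proof.
move=> sl hl; elim: w => [|w IH]; first exact: pc0.
apply: pc_trans IH.
have := pc_lcn_list (fun x => @lcl_lcn l w x).
rewrite size_lcl sl; congr pc; apply: pred_ext => x; split; last exact: lcn_gen.
apply: gen_min; first exact: gnormal_sub (gnormal_lcn w).
by move=> y [/lcnS|/lcl_lcn].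
Qed.

Definition ucs := cs triv (full G).

Lemma gnormal_ucs i : gnormal (ucs i).
Proof.
have J j x g : ucs j x -> ucs j (gconj x g).
  elim: j x => [x ->|j IH x h k _]; first exact: gconj1.
  have -> : gcomm (gconj x g) k = gconj (gcomm x (gconj k (ginv g))) g by gsolve.
  by apply: IH; apply: h.
split; last by move=> x g hx _; apply: J.
split; first by apply: cs_one; apply: sub_triv.
split=> [x y|x].
  elim: i x y => [x y -> ->|i IH x y hx hy g _]; first exact: gmul1.
  have -> : gcomm (x *g y) g = gconj (gcomm x g) y *g gcomm y g by gsolve.
  by apply: IH; [apply: J; apply: hx | apply: hy].
elim: i x => [x ->|i IH x hx g _]; first exact: ginv1.
have -> : gcomm (ginv x) g = gconj (ginv (gcomm x g)) (ginv x) by gsolve.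
by apply: J; apply: IH; apply: hx.
Qed.

Lemma lcn_ucs c N : gsubset (lcn c) (ucs N) -> gsubset (lcn (c + N)) triv.
Proof.
elim: N c => [|N IH] c h; first by rewrite addn0.
rewrite addnS -addSn; apply: IH; apply: gen_min; first exact: gnormal_sub (gnormal_ucs _).
by move=> _ [u [g [/h hu ->]]]; apply: hu.
Qed.

Lemma nilpotent_ucs c : gsubset (lcn c) triv -> forall x, ucs c x.
Proof.
move=> h x.
suff: forall i x, i <= c -> lcn (c - i) x -> ucs i x.
  by move/(_ c x (leqnn c)); rewrite subnn; apply.
elim=> [|i IH] {}x; first by rewrite subn0 => _ /h.
move=> lt hx g _; apply: IH; first exact: ltnW.
by rewrite -subSS subSn //; apply: lcnR.
Qed.

Lemma derived_ucs N H : gsubset H (ucs N) -> gsubset (derived N H) triv.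
Proof.
elim: N H => // N IH H h; rewrite -addn1 => x; rewrite derivedD.
apply: IH => {}x; apply: gen_min; first exact: gnormal_sub (gnormal_ucs _).
by move=> _ [a [b [/h ha [_ ->]]]]; apply: ha.
Qed.

Lemma gen_abel S : (forall a b, S a -> S b -> a *g b = b *g a) -> abel (gen S).
Proof.
move=> h a b ha hb; apply/gcomm_eq1.
by apply: (comm_gen (@gnormal_triv G) _ ha hb) => x y hx hy; apply/gcomm_eq1/h.
Qed.

End RelativeCentralSeries.

(** * Bounded nilpotency of boundedly generated subgroups *)

Lemma section_lcn (G Q : grp) (N : G -> Prop) (f : G -> Q) i x :
  is_section N (full G) f -> lcn i x -> lcn i (f x).
Proof.
move=> [sK sN NK [hf surj ker]]; elim: i x => // i IH x hx /=.
apply: gen_mono (img_gen sK hf _ hx) => // _ [_ [[u [g [hu ->]]] <-]].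
by exists (f u), (f g); rewrite (homR sK hf) //; split=> //; apply: IH.
Qed.

(* Gruenberg's theorem with bounds. *)
Lemma engel_soluble_nilpotent k e d : exists c, forall G, engel e G ->
  forall l : seq G, size l = k -> (forall x, glist l x) ->
  soluble_le (full G) d -> forall x : G, lcn c x -> x = gone G.
Proof.
(* [lcn c] lies in the abelian [A] and so acts trivially on it: this is the factor 1. Above [lcn c]
   there are [plen k c] cyclic steps, each of which multiplies the length by [e]. *)
elim: d => [|d [c IH]]; first by exists 0 => G _ l _ _ h x _; apply: h.
exists (c + 1 * e ^ plen k c) => G en l sl hl sol.
set A := derived d (full G).
have nA : gnormal A by apply: gnormal_derived; apply: gnormal_full.
have aA : abel A.
  move=> a b ha hb; apply/gcomm_eq1; apply: sol; apply: gen_in.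
  by exists a, b.
have [Q [f sec]] := quotient_exists nA.
have lcA : gsubset (lcn c) A.
  move=> x /(section_lcn sec) hx.
  case: (sec) => _ _ _ [_ _ ker]; apply/ker => //.
  apply: (IH Q (section_engel sec en) (map f l)) hx.
  - by rewrite size_map.
  - exact: (section_gen sec).
  - by apply/(section_soluble sec).
apply: lcn_ucs => x /lcA; apply: (pc_act nA aA en (pc_lcn c sl hl)) => {}x ax g gc.
by apply/gcomm_eq1; apply: aA => //; apply: lcA.
Qed.

(** Factor out the normal closure [N] of one generator. Its [s]-th derived group lies in a cyclic
    group, so [N] has derived length at most [s.+1], and the quotient needs one generator less. *)
Lemma good_list_soluble s e k (G : grp) (l : seq G) : good s e G -> size l = k ->
  soluble_le (glist l) (k * s.+1).
Proof.
elim: k G l => [|k IH] G [|x l] gG //.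
  by move=> _ x; apply: (gen_min (@sub_triv G)).
move=> [sl].
set H := gen (fun y => y = x).
have nN := gnormal_ncl H; set N := ncl H in nN.
have [Q [f sec]] := quotient_exists nN.
have solQ := IH _ (map f l) (section_good sec gG) (etrans (size_map _ _) sl).
case: (sec) => sK _ _ [hf _ ker].
move=> y; rewrite mulSn derivedD => hy.
have aH : abel H by apply: gen_abel => a b -> ->.
apply: (derived_comm_triv aH).
suff: derived (1 + s) N y.
  by rewrite derivedD; apply: derived_mono; case: gG => h _; apply: h; apply: sub_gen.
apply: derived_mono hy => {}y dy; apply/ker => //.
apply: solQ.
have := img_derived sK hf (H := glist (x :: l)) _ (sub_gen _) dy.
move=> /(_ (fun _ _ => I)); apply: derived_mono => _ [z [hz <-]].
have sP := sub_preim sK hf (sub_gen (fun y => List.In y (map f l))).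
apply: (proj2 (gen_min sP _ hz)) => t [<-|ht]; split=> //; last first.
  by apply: gen_in; apply: List.in_map.
have -> : f x = gone Q; last exact: gen_one.
by apply/ker => //; apply: ncl_sub; apply: gen_in.
Qed.

(** * Finitely generated abelian groups *)

Lemma lift_list (X Y : Type) (f : X -> Y) (P : X -> Prop) (l : seq Y) :
  (forall y, List.In y l -> exists x, P x /\ f x = y) ->
  exists l', map f l' = l /\ forall x, List.In x l' -> P x.
Proof.
elim: l => [|y l IH] h; first by exists nil.
have [|l' [e hl]] := IH; first by move=> z hz; apply: h; right.
have [x [px ex]] := h y (or_introl erefl).
by exists (x :: l'); split=> [|z [<- //|/hl]]; rewrite //= e ex.
Qed.

(** The generated subgroup, taken as a group of its own, is again [good]; its lower central series
    refines to [plen k c] cyclic steps, which gives [r]. *)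
Lemma good_list_nilpotent s e k : exists c r, forall (G : grp) (l : seq G),
  good s e G -> size l = k ->
  (forall a, glist l a -> cs (fun x => x = gone G) (glist l) c a) /\
  (forall K, is_subgroup K -> gsubset K (glist l) ->
     exists l', size l' = r /\ forall x, K x <-> glist l' x).
Proof.
have [c hc] := engel_soluble_nilpotent k e (k * s.+1).
exists c, (plen k c) => G l gG sl.
set H := glist l; have sH : is_subgroup H by apply: sub_gen.
have [Q [f sec]] := subgrp_exists sH.
have gQ := section_good sec gG.
have lQ : forall y, glist (map f l) y.
  by apply: (section_gen sec) => // x hx; apply: gen_in.
have slQ : size (map f l) = k by rewrite size_map.
have solQ : soluble_le (full Q) (k * s.+1).
  by apply/(section_soluble sec); apply: good_list_soluble gG sl.
have nilQ := hc Q (proj2 gQ) _ slQ lQ solQ.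
case: (sec) => _ _ _ [hf surj ker].
split=> [a ha|K sK KH].
  have : cs (fun x => x = gone Q) (full Q) c (f a) by apply: nilpotent_ucs.
  elim: (c) a ha => [|i IH] a ha; first by move/ker; apply.
  by move=> h g hg; apply: IH; [apply: subR | rewrite (homR sH hf) //; apply: h].
have [|l' [sl' hl']] := pc_subgroup_gen (gnormal_sub (gnormal_lcn Q c)) nilQ
   (pc_lcn c slQ lQ) (sub_img sH hf KH sK); first by [].
have [y hy|l2 [e2 h2]] := @lift_list _ _ f K l'.
  by have /hl' : glist l' y by apply: gen_in.
exists l2; split; first by rewrite -sl' -e2 size_map.
move=> x; split=> [kx|]; last exact: gen_min.
have : glist l' (f x) by apply/hl'; exists x.
rewrite -e2 => hx.
have l2H : gsubset (fun x => List.In x l2) H by move=> z /h2 /KH.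
have [] := @gen_img _ _ H f sH hf (fun x => List.In x l2) l2H (f x).
  by apply: gen_mono hx => z /List.in_map_iff [t [<- ht]]; exists t.
move=> z [hz ez]; have zH : H z by apply: gen_min hz.
have := section_eq sec zH (KH _ kx) ez.
by move/(congr1 (gmul z)); rewrite gmulVKr gmul1r => ->.
Qed.

(** * Linear algebra modulo a prime power *)

Lemma dvd_ZofN a b : (Z.of_nat a | Z.of_nat b)%Z <-> a %| b.
Proof.
split=> [[k h]|/dvdnP [k ->]]; last by exists (Z.of_nat k); lia.
apply/dvdnP; exists (Z.to_nat (Z.abs k)); nia.
Qed.

Lemma Zunit_mod p e z : prime p -> ~ (Z.of_nat p | z)%Z ->
  exists u, (Z.of_nat (p ^ e) | 1 - u * z)%Z.
Proof.
move=> pp hz; set m := Z.to_nat (Z.abs z).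
have zm : z = Z.of_nat m \/ z = (- Z.of_nat m)%Z by lia.
have ndv : ~~ (p %| m).
  apply/negP => /dvd_ZofN h; apply: hz.
  by case: zm => -> //; apply/Z.divide_opp_r.
have co : coprime (p ^ e) m by apply: coprimeXl; rewrite prime_coprime.
have q0 : 0 < p ^ e by rewrite expn_gt0 prime_gt0.
have [a _] := Bezoutl m q0; rewrite (eqP co) => /dvd_ZofN.
have -> : Z.of_nat (1 + a * m) = (1 + Z.of_nat a * Z.of_nat m)%Z by lia.
by case: zm => -> h; [exists (- Z.of_nat a)%Z | exists (Z.of_nat a)];
  apply: etrans h || (move: h; congr Z.divide; lia).
Qed.

(* Divisibility is total among the residues modulo a prime power. *)
Lemma residues_principal (I : Type) (i0 : I) p e (a : I -> Z) : prime p ->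
  exists g0, forall g, exists c, (Z.of_nat (p ^ e) | a g - c * a g0)%Z.
Proof.
move=> pp; elim: e a => [|e IH] a.
  by exists i0 => g; exists 0%Z; rewrite expn0; apply: Z.divide_1_l.
case: (classic (exists g, ~ (Z.of_nat p | a g)%Z)) => [[g0 h]|h].
  exists g0 => g; have [u hu] := Zunit_mod e.+1 pp h.
  exists (a g * u)%Z; have -> : (a g - a g * u * a g0 = a g * (1 - u * a g0))%Z by ring.
  exact: Z.divide_mul_r.
have hp g : exists b, a g = (b * Z.of_nat p)%Z.
  by apply: NNPP => nb; apply: h; exists g => -[b hb]; apply: nb; exists b.
pose b g := proj1_sig (constructive_indefinite_description _ (hp g)).
have hb g : a g = (b g * Z.of_nat p)%Z.
  by rewrite /b; case: constructive_indefinite_description.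
have [g0 h0] := IH b; exists g0 => g; have [c hc] := h0 g; exists c.
rewrite !hb expnSr.
have -> : Z.of_nat (p ^ e * p) = (Z.of_nat (p ^ e) * Z.of_nat p)%Z by lia.
have -> : (b g * Z.of_nat p - c * (b g0 * Z.of_nat p) =
  (b g - c * b g0) * Z.of_nat p)%Z by ring.
exact: Z.mul_divide_mono_r.
Qed.

(** Gaussian elimination over Z/p^e: in each column some row has an entry dividing all others there,
    and subtracting multiples of that row clears the column. The predicate [P] stands for a
    submodule containing all multiples of [p^e]. The pivots are indices of the original family,
    which is the point of working over a local ring. *)
Lemma prime_power_span (I : Type) (i0 : I) (T : eqType) p e (J : seq T) (M : I -> T -> Z) :
  prime p -> (forall g t, t \notin J -> (Z.of_nat (p ^ e) | M g t)%Z) ->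
  exists l, size l = size J /\ forall P : (T -> Z) -> Prop,
    P (fun _ => 0%Z) ->
    (forall w w' c, P w -> P w' -> P (fun t => (w t + c * w' t)%Z)) ->
    (forall w w', P w -> (forall t, (Z.of_nat (p ^ e) | w' t - w t)%Z) -> P w') ->
    (forall g, List.In g l -> P (M g)) -> forall g, P (M g).
Proof.
move=> pp; elim: J M => [|t J IH] M hM.
  exists nil; split=> // P P0 _ Pq _ g; apply: Pq P0 _ => t.
  by rewrite Z.sub_0_r; apply: hM.
have [g0 h0] := residues_principal i0 e (fun g => M g t) pp.
pose c g := proj1_sig (constructive_indefinite_description _ (h0 g)).
have hc g : (Z.of_nat (p ^ e) | M g t - c g * M g0 t)%Z.
  by rewrite /c; case: constructive_indefinite_description.
have [|l [sl hl]] := IH (fun g t => M g t - c g * M g0 t)%Z.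
  move=> g t' ht'; case: (eqVneq t' t) => [->|ne]; first exact: hc.
  have nt : t' \notin t :: J by rewrite inE negb_or ne.
  by apply: Z.divide_sub_r; [apply: hM | apply: Z.divide_mul_r; apply: hM].
exists (g0 :: l); split; first by rewrite /= sl.
move=> P P0 PD Pq Pl g.
have P1 : P (M g0) by apply: Pl; left.
have step b w w' : P w -> (forall t, w' t = w t + b * M g0 t)%Z -> P w'.
  move=> pw h; apply: Pq (PD _ _ b pw P1) _ => t'; rewrite h Z.sub_diag.
  exact: Z.divide_0_r.
apply: (step (c g) (fun t => M g t - c g * M g0 t)%Z); last by move=> t'; ring.
apply: hl => // g' hg'.
by apply: (step (- c g')%Z (M g')); [apply: Pl; right | move=> t'; ring].
Qed.

Section Lin.
Variables (G : grp) (A : G -> Prop).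
Hypotheses (sA : is_subgroup A) (aA : abel A).

Fixpoint lin (l : seq G) (v : nat -> Z) : G :=
  if l is a :: l' then zp a (v 0) *g lin l' (fun i => v i.+1) else gone G.

Lemma lin_in l v : (forall a, List.In a l -> A a) -> A (lin l v).
Proof.
elim: l v => [|a l IH] v h /=; first exact: sub1.
apply: subM => //; first by apply: sub_zp => //; apply: h; left.
by apply: IH => b hb; apply: h; right.
Qed.

Lemma abel_swap a b c d : A b -> A c -> a *g b *g (c *g d) = a *g c *g (b *g d).
Proof. by move=> hb hc; rewrite -!gmulA (gmulA b) (aA hb hc) !gmulA. Qed.

Lemma lin_addZ l v w c : (forall a, List.In a l -> A a) ->
  lin l (fun i => v i + c * w i)%Z = lin l v *g zp (lin l w) c.
Proof.
elim: l v w => [|a l IH] v w h /=; first by rewrite zp_one gmul1.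
have hl b : List.In b l -> A b by move=> hb; apply: h; right.
have ha : A a by apply: h; left.
rewrite (IH (fun i => v i.+1) (fun i => w i.+1)) // zpD.
rewrite zp_mulC; last by apply: aA; [apply: sub_zp | apply: lin_in].
rewrite -zpM (Z.mul_comm c) abel_swap //; first exact: sub_zp.
exact: lin_in.
Qed.

Lemma lin0 l : lin l (fun _ => 0%Z) = gone G.
Proof. by elim: l => //= a l ->; rewrite gmul1. Qed.

Lemma lin_ext l v w : (forall i, i < size l -> v i = w i) -> lin l v = lin l w.
Proof.
elim: l v w => //= a l IH v w h; rewrite h // (IH _ (fun i => w i.+1)) // => i hi.
exact: h.
Qed.

Lemma glist_lin l x : (forall a, List.In a l -> A a) -> glist l x -> exists v, x = lin l v.
Proof.
move=> h.
have sL : is_subgroup (fun x => exists v, x = lin l v).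
  split; first by exists (fun _ => 0%Z); rewrite lin0.
  split=> [_ _ [v ->] [w ->]|_ [v ->]].
    by exists (fun i => v i + 1 * w i)%Z; rewrite lin_addZ // zp1.
  exists (fun i => 0 + (-1) * v i)%Z; rewrite (lin_addZ (fun _ => 0%Z)) // lin0 gmul1.
  by rewrite (zpN _ 1) zp1.
apply: (gen_min sL) => y; elim: l {h sL} => //= a l IH [<-|/IH [v ->]].
  exists (fun i => if i is 0 then 1%Z else 0%Z).
  by rewrite -[RHS]/(zp a 1 *g lin l (fun _ => 0%Z)) lin0 zp1 gmul1r.
exists (fun i => if i is j.+1 then v j else 0%Z); rewrite /= gmul1.
exact: lin_ext.
Qed.

Lemma lin_mapM (I : Type) (s : seq I) (b b' : I -> G) c v :
  (forall i, A (b i)) -> (forall i, A (b' i)) ->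
  lin (map (fun i => b i *g zp (b' i) c) s) v =
  lin (map b s) v *g zp (lin (map b' s) v) c.
Proof.
move=> hb hb'; elim: s v => [|i s IH] v /=; first by rewrite zp_one gmul1.
have hs (d : I -> G) : (forall i, A (d i)) -> forall w, A (lin (map d s) w).
  by move=> hd w; apply: lin_in => a /List.in_map_iff [j [<- _]].
rewrite IH zp_mulC; last by apply: aA => //; apply: sub_zp.
rewrite zp_mulC; last by apply: aA; [apply: sub_zp | apply: hs].
by rewrite -!zpM Z.mul_comm abel_swap //; [apply: sub_zp | apply: hs].
Qed.

End Lin.

Lemma abel_comm_zp (G : grp) (A : G -> Prop) a g k : gnormal A -> abel A -> A a ->
  gcomm (zp a k) g = zp (gcomm a g) k.
Proof.
move=> nA aA ha; have sA := gnormal_sub nA; elim/zp_ind: k => [|k]; first exact: gcomm1.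
rewrite !zpS (abel_commM nA aA) //; last exact: sub_zp.
by split=> [->//|]; apply: gmul_injr.
Qed.

Lemma lin_comm (G : grp) (A : G -> Prop) l v g : gnormal A -> abel A ->
  (forall a, List.In a l -> A a) ->
  gcomm (lin l v) g = lin (map (fun a => gcomm a g) l) v.
Proof.
move=> nA aA; have sA := gnormal_sub nA.
elim: l v => [|a l IH] v h /=; first exact: gcomm1.
have hl b : List.In b l -> A b by move=> hb; apply: h; right.
have ha : A a by apply: h; left.
rewrite (abel_commM nA aA) ?(abel_comm_zp _ _ nA) ?IH //; first exact: sub_zp.
exact: lin_in.
Qed.

(* A subgroup M maximal subject to x not in M exists, and A / M is then a p-group
   whose order-p subgroup is generated by x. *)
Lemma fg_abelian_residual (G : grp) (A : G -> Prop) (l : seq G) x :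
  abel A -> (forall y, A y <-> glist l y) -> A x ->
  (forall p e, prime p -> exists y, A y /\ x = zp y (Z.of_nat (p ^ e))) -> x = gone G.
Proof.
move=> aA Al ax hdiv; apply: NNPP => x1.
have sA : is_subgroup A by apply: sub_ext (sub_gen (fun y => List.In y l)) => y; symmetry.
(* Zorn's lemma is applied to arbitrary subsets, so the union of a chain needs no subgroup
   structure; the subgroup itself is [M = gen S]. *)
pose P (S : G -> Prop) := gsubset S A /\ ~ gen S x.
have [S [[SA Sx] Smax]] : exists S : G -> Prop, P S /\
    forall B : G -> Prop, classical_sets.proper S B -> ~ P B.
  apply: (@classical_sets.Zorn_bigcup G P) => F FP Ft.
  split; first by move=> y [S FS Sy]; case: (FP S FS) => h _; apply: h.
  move=> gx.
  have sU : is_subgroup (fun y => y = gone G \/ exists S, F S /\ gen S y).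
    split; first by left.
    split=> [y z|y]; last first.
      case=> [->|[S [FS hy]]]; first by left; rewrite ginv1.
      by right; exists S; split=> //; apply: gen_inv.
    case=> [->|[S [FS hy]]]; first by rewrite gmul1.
    case=> [->|[S' [FS' hz]]]; first by rewrite gmul1r; right; exists S.
    right; case: (Ft S S' FS FS') => h.
      by exists S'; split=> //; apply: gen_mul => //; apply: gen_mono hy => t; apply: h.
    by exists S; split=> //; apply: gen_mul => //; apply: gen_mono hz => t; apply: h.
  have [|//|[S [FS]]] := gen_min sU _ gx; last by case: (FP S FS).
  by move=> y [S FS Sy]; right; exists S; split=> //; apply: gen_in.
set M := gen S.
have sM : is_subgroup M by apply: sub_gen.
have MA : gsubset M A by apply: gen_min.
have ex b : A b -> ~ M b -> exists m j, M m /\ x = m *g zp b j.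
  move=> ab nb; have MJ g p : A g -> M p -> M (gconj p g).
    by move=> ag mp; rewrite /gconj (aA _ _ (MA _ mp) ag) gmulKr.
  apply/(coset_form sM); try by move=> p; apply: MJ => //; apply: subV.
  apply: NNPP => nx; apply: (Smax (fun y => S y \/ y = b)).
    split; first by move=> y hy; left.
    by move/(_ b (or_intror erefl)) => hb; apply: nb; apply: gen_in.
  split; first by move=> y [/SA|->].
  by move=> h; apply: nx; apply: gen_mono h => y [hy|->]; [left; apply: gen_in | right].
have pw b m j k : A b -> M m -> x = m *g zp b j -> M (zp b k) -> M (zp x k).
  move=> ab mm e mk; rewrite e zp_mulC; last by apply: aA; [apply: MA | apply: sub_zp].
  apply: subM => //; first exact: sub_zp.
  by rewrite -zpM Z.mul_comm zpM; apply: sub_zp.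
have key b n r : A b -> r %| n -> M (zp b (Z.of_nat n)) ->
    M (zp b (Z.of_nat (n %/ r))) \/ M (zp x (Z.of_nat r)).
  move=> ab rn h; case: (classic (M (zp b (Z.of_nat (n %/ r))))) => h'; [by left | right].
  have [|m [j [mm e]]] := ex _ _ h'; first exact: sub_zp.
  apply: pw mm e _; first exact: sub_zp.
  rewrite -zpM; suff -> : (Z.of_nat (n %/ r) * Z.of_nat r)%Z = Z.of_nat n by [].
  by rewrite -{2}(divnK rn); lia.
have absn b k : M (zp b k) -> M (zp b (Z.of_nat (Z.to_nat (Z.abs k)))).
  move=> h; have [->|->] : Z.of_nat (Z.to_nat (Z.abs k)) = k \/
    Z.of_nat (Z.to_nat (Z.abs k)) = (- k)%Z by lia.
    exact: h.
  by rewrite zpN; apply: subV.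
(* If [zp x 2] is outside [M], maximality writes [x] as an element of [M] times [zp x (2 * j)]; then
   [1 - 2 * j] is odd, hence a nonzero exponent. *)
have [n [n0 xn]] : exists n, 0 < n /\ M (zp x (Z.of_nat n)).
  case: (classic (M (zp x 2))) => [h|h]; first by exists 2.
  have [|m [j [mm e]]] := ex (zp x 2) _ h; first exact: sub_zp.
  have h2 : M (zp x (1 - 2 * j)).
    by rewrite /Z.sub zpD zp1 zpN zpM {1}e -gmulA gmulVr gmul1r.
  by exists (Z.to_nat (Z.abs (1 - 2 * j))); split; [lia | apply: absn].
have [p [pp xp]] : exists p, prime p /\ M (zp x (Z.of_nat p)).
  elim/ltn_ind: n n0 xn => n IH n0 xn.
  have [n1|n1] : 1 < n \/ n = 1 by lia.
    case: (key _ _ _ ax (pdiv_dvd n) xn) => h.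
      apply: IH h; first by rewrite ltn_Pdiv ?prime_gt1 ?pdiv_prime.
      by rewrite divn_gt0 ?pdiv_gt0 // dvdn_leq ?pdiv_dvd.
    by exists (pdiv n); split=> //; apply: pdiv_prime.
  by case: Sx; move: xn; rewrite n1 zp1.
have pexp b : A b -> exists e, M (zp b (Z.of_nat (p ^ e))).
  move=> ab; have [k [k0 bk]] : exists k, 0 < k /\ M (zp b (Z.of_nat k)).
    case: (classic (M b)) => [h|h]; first by exists 1; rewrite zp1.
    have [m [j [mm e]]] := ex _ ab h.
    exists (Z.to_nat (Z.abs (j * Z.of_nat p))); split.
      have p0 := prime_gt0 pp.
      have : j <> 0%Z by move=> j0; apply: Sx; rewrite -/M e j0 gmul1r.
      nia.
    apply: absn; move: xp.
    rewrite e zp_mulC; last by apply: aA; [apply: MA | apply: sub_zp].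
    by rewrite -zpM => /(subMl _ sM); apply; apply: sub_zp.
  elim/ltn_ind: k b ab k0 bk => k IH b ab k0 bk.
  have [k1|k1] : 1 < k \/ k = 1 by lia.
    have rk := pdiv_dvd k; have pr := pdiv_prime k1; set r := pdiv k in rk pr.
    have lt : k %/ r < k by rewrite ltn_Pdiv ?prime_gt1.
    have gt : 0 < k %/ r by rewrite divn_gt0 ?prime_gt0 // dvdn_leq.
    have [rp|rp] := eqVneq r p.
      have [||e he] := IH _ lt (zp b (Z.of_nat p)) _ gt.
      - exact: sub_zp.
      - rewrite -zpM; suff -> : (Z.of_nat p * Z.of_nat (k %/ r))%Z = Z.of_nat k by [].
        by rewrite -{2}(divnK rk) rp; lia.
      exists e.+1; move: he; rewrite -zpM expnS.
      by have -> : (Z.of_nat p * Z.of_nat (p ^ e) = Z.of_nat (p * p ^ e))%Z by lia.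
    case: (key _ _ _ ab rk bk) => h; first exact: IH h.
    case: Sx; have co : coprime p r by rewrite prime_coprime // dvdn_prime2 // eq_sym.
    have [a _] := Bezoutl r (prime_gt0 pp); rewrite (eqP co) => /dvd_ZofN [t ht].
    have -> : x = zp (zp x (Z.of_nat p)) t *g zp (zp x (Z.of_nat r)) (- Z.of_nat a).
      rewrite -!zpM -zpD.
      suff -> : (Z.of_nat p * t + Z.of_nat r * - Z.of_nat a = 1)%Z by rewrite zp1.
      by move: ht; lia.
    by apply: subM => //; apply: sub_zp.
  by exists 0; move: bk; rewrite k1.
(* Finitely many generators share one exponent [p ^ E] modulo [M]. As [x] is a [p ^ E]-th power in
   [A], it falls into [M], a contradiction. *)
have [E hE] : exists E, forall b, List.In b l -> M (zp b (Z.of_nat (p ^ E))).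
  have lA b : List.In b l -> A b by move=> hb; apply/Al; apply: gen_in.
  elim: (l) lA => [|b l' IH] lA; first by exists 0.
  have [|E hE] := IH; first by move=> c hc; apply: lA; right.
  have [e he] := pexp b (lA b (or_introl erefl)).
  exists (e + E) => c [<-|/hE hc]; rewrite expnD.
    have -> : Z.of_nat (p ^ e * p ^ E) = (Z.of_nat (p ^ e) * Z.of_nat (p ^ E))%Z by lia.
    by rewrite zpM; apply: sub_zp.
  have -> : Z.of_nat (p ^ e * p ^ E) = (Z.of_nat (p ^ E) * Z.of_nat (p ^ e))%Z by lia.
  by rewrite zpM; apply: sub_zp.
have [y [ay xy]] := hdiv p E pp.
have sB : is_subgroup (fun b => A b /\ M (zp b (Z.of_nat (p ^ E)))).
  split; first by rewrite zp_one; split; apply: sub1.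
  split=> [b c [ab mb] [ac mc]|b [ab mb]].
    by split; [apply: subM | rewrite zp_mulC; [apply: subM | apply: aA]].
  by split; [apply: subV | rewrite -zpN1 -zpM Z.mul_comm zpM zpN1; apply: subV].
have [|_ my] := gen_min sB _ (proj1 (Al y) ay); last by apply: Sx; rewrite xy.
by move=> b hb; split; [apply/Al; apply: gen_in | apply: hE].
Qed.

(** * Solubility of groups with all subgroups subnormal *)

Lemma cs_comp (G : grp) (B S : G -> Prop) m c x : cs (cs B S m) S c x -> cs B S (c + m) x.
Proof. by elim: c x => //= c IH x h g hg; apply: IH; apply: h. Qed.

(* Modulo A^q, for a prime power q, the operators a |-> [a, g] are r x r matrices over
   Z/q, so r^2 of them span all the others; the finitely many elements g involved
   generate a nilpotent group of bounded class. *)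
Lemma good_fg_abelian_ucs s e r : exists c, forall (G : grp) (A : G -> Prop) (l : seq G),
  good s e G -> gnormal A -> abel A -> size l = r -> (forall x, A x <-> glist l x) ->
  gsubset A (ucs c).
Proof.
(* [r * r] elements for the spanning operators and [r] for the generators of [A], so that both lie
   in one nilpotent subgroup. *)
have [c [r' hc]] := good_list_nilpotent s e (r * r + r).
exists c => G A l gG nA aA sl Al.
have sA := gnormal_sub nA.
have lA a : List.In a l -> A a by move=> h; apply/Al; apply: gen_in.
have coef g i : exists v, gcomm (nth (gone G) l i) g = lin l v.
  apply: (glist_lin sA aA lA); apply/Al; apply: gnormalRl => //.
  elim: (l) lA i => [|a l' IH] lA' [|i] //=; try exact: sub1.
    by apply: lA'; left.
  by apply: IH => b hb; apply: lA'; right.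
pose M0 g i := proj1_sig (constructive_indefinite_description _ (coef g i)).
have hM0 g i : gcomm (nth (gone G) l i) g = lin l (M0 g i).
  by rewrite /M0; case: constructive_indefinite_description.
pose M g (t : nat * nat) := if (t.1 < r) && (t.2 < r) then M0 g t.1 t.2 else 0%Z.
pose act v (w : nat * nat -> Z) := lin (map (fun i => lin l (fun j => w (i, j))) (iota 0 r)) v.
have linlA v : A (lin l v) by apply: lin_in.
have actA v w : A (act v w).
  by apply: lin_in => // a /List.in_map_iff [i [<- _]].
have actM v g : act v (M g) = gcomm (lin l v) g.
  rewrite (lin_comm v g nA aA lA) /act; congr lin.
  rewrite -{2}(mkseq_nth (gone G) l) sl /mkseq -map_comp.
  apply/eq_in_map => i; rewrite mem_iota /= add0n => ir.
  rewrite hM0; apply: lin_ext => j; rewrite sl /M /= => jr.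
  by rewrite ir jr.
have act_addZ v w w' k : act v (fun t => w t + k * w' t)%Z = act v w *g zp (act v w') k.
  rewrite /act -(lin_mapM sA aA) //; congr lin; apply: eq_map => i.
  by rewrite (lin_addZ sA aA).
have act0 v : act v (fun _ => 0%Z) = gone G.
  rewrite /act; elim: (iota 0 r) v => //= i t IH v.
  by rewrite IH lin0 zp_one gmul1.
move=> a aa.
(* [c] is independent of the prime power, so the claims modulo all [A^q] combine, by
   [fg_abelian_residual], into the claim in [A]. *)
suff hq p f : prime p -> cs (fun x => exists y, A y /\ x = zp y (Z.of_nat (p ^ f))) (full G) c a.
  have : cs (fun x => A x /\ forall p f, prime p -> exists y, A y /\ x = zp y (Z.of_nat (p ^ f)))
     (full G) c a.
    elim: (c) a aa hq => [|i IH] b ab hq; first by split=> // p f pp; apply: hq.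
    move=> g _; apply: IH => [|p f pp]; first exact: gnormalRl.
    exact: hq.
  by apply: cs_mono => // x [ax hx]; apply: (fg_abelian_residual aA Al).
move=> pp; set q := Z.of_nat (p ^ f).
pose Aq x := exists y, A y /\ x = zp y q.
have sAq : is_subgroup Aq.
  split; first by exists (gone G); rewrite zp_one; split=> //; apply: sub1.
  split=> [_ _ [y [ay ->]] [z [az ->]]|_ [y [ay ->]]].
    by exists (y *g z); rewrite zp_mulC; [split=> //; apply: subM | apply: aA].
  by exists (ginv y); rewrite -!zpN1 -!zpM Z.mul_comm; split=> //; apply: sub_zp.
pose J := [seq (i, j) | i <- iota 0 r, j <- iota 0 r].
have sJ : size J = r * r by rewrite size_allpairs size_iota.
have [|lg [slg hlg]] := @prime_power_span G (gone G) _ p f J M pp.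
  move=> g [i j] h; rewrite /M /=; case: ifP => [/andP[ir jr]|_]; last exact: Z.divide_0_r.
  by case/negP: h; apply/allpairsP; exists (i, j); rewrite !mem_iota.
have [|csH _] := hc G (lg ++ l) gG; first by rewrite size_cat slg sJ sl.
pose X x := List.In x lg.
have inl x : glist l x -> glist (lg ++ l) x.
  by apply: gen_mono => y hy; apply/List.in_or_app; right.
have : cs Aq X c a.
  apply: (cs_mono _ _ (csH a (inl a (proj1 (Al a) aa)))) => [x ->|x hx]; first exact: sub1.
  by apply: gen_in; apply/List.in_or_app; left.
elim: (c) a aa => // i IH b ab hb g _.
apply: IH; first exact: gnormalRl.
have [v ev] := glist_lin sA aA lA (proj1 (Al b) ab).
rewrite {1}ev -actM.
(* For fixed [v], the matrices [w] that send [lin l v] into this term form a submodule containing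
   the multiples of [q]; it contains the chosen operators by [hb], hence all operators. *)
apply: (hlg (fun w => cs Aq X i (act v w))).
- by rewrite act0; apply: cs_one.
- move=> w w' k h h'; rewrite act_addZ.
  have sC := cs_sub nA aA X i sAq.
  case: (@subM _ _ (act v w) (zp (act v w') k) sC) => //.
  exact: (sub_zp _ sC).
- move=> w w' h hww.
  have hd t : exists d, w' t = (w t + q * d)%Z.
    by have [d hd] := hww t; exists d; lia.
  pose d t := proj1_sig (constructive_indefinite_description _ (hd t)).
  have -> : w' = (fun t => w t + q * d t)%Z.
    apply: functional_extensionality => t; rewrite /d.
    by case: constructive_indefinite_description.
  rewrite act_addZ; apply: (csM nA aA) => //; first exact: sub_zp.
  have : Aq (zp (act v d) q) by exists (act v d).
  have : A (zp (act v d) q) by exact: sub_zp.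
  elim: (i) (zp (act v d) q) => // i' IH y ay [z [az ->]] h' _.
  apply: IH; first by apply: gnormalRl => //; apply: sub_zp.
  exists (gcomm z h'); split; first exact: gnormalRl.
  exact: (abel_comm_zp _ _ nA).
by move=> h hh; rewrite actM -ev; apply: hb.
Qed.

(** The derived series of [L] has at most [D = k * s.+1] factors. Climbing it from the bottom, each
    factor is an [r]-generator abelian normal subgroup of a quotient of [G] and costs [c] central
    steps. *)
Lemma good_normal_in_list_ucs s e k : exists N, forall (G : grp) (L : G -> Prop) (l : seq G),
  good s e G -> gnormal L -> size l = k -> gsubset L (glist l) -> gsubset L (ucs N).
Proof.
have [c0 [r hr]] := good_list_nilpotent s e k.
have [c hc] := good_fg_abelian_ucs s e r.
pose D := k * s.+1.
exists (D * c) => G L l gG nL sl Ll.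
suff h j : j <= D -> gsubset (derived (D - j) L) (ucs (j * c)).
  by have := h D (leqnn D); rewrite subnn.
elim: j => [_ x|j IH ltj].
  rewrite subn0 => hx; apply: (good_list_soluble gG sl).
  exact: derived_mono hx.
set i := D - j.+1; have ei : D - j = i.+1 by rewrite -subSn.
rewrite ei in IH.
have nN := gnormal_derived i.+1 nL.
have [Q [f sec]] := quotient_exists nN.
case: (sec) => sK _ _ [hf surj ker].
have nLi := gnormal_derived i nL.
have LiL : gsubset (derived i L) (glist l).
  by move=> x /(derived_sub (gnormal_sub nL)) /Ll.
have [l' [sl' hl']] := proj2 (hr G l gG sl) _ (gnormal_sub nLi) LiL.
set A := img f (derived i L).
have nA : gnormal A.
  split; first by apply: (sub_img sK hf) => //; apply: gnormal_sub nLi.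
  move=> _ y [x [hx <-]] _; have [g [_ <-]] := surj y.
  by exists (gconj x g); rewrite (homJ sK hf) //; split=> //; apply: gnormalJ.
have aA : abel A.
  move=> _ _ [x [hx <-]] [y [hy <-]]; apply/gcomm_eq1.
  rewrite -(homR sK hf) //; apply/ker => //; apply: gen_in.
  by exists x, y.
have Al x : A x <-> glist (map f l') x.
  split=> [[y [/hl' hy <-]]|hx].
    have := @img_gen _ _ (full G) f sK hf (fun x => List.In x l') (fun _ _ => I) y hy.
    by apply: gen_mono => _ [z [hz <-]]; apply: List.in_map.
  apply: (gen_min (gnormal_sub nA) _ hx) => z /List.in_map_iff [t [<- ht]].
  by exists t; split=> //; apply/hl'; apply: gen_in.
have hA := hc Q A (map f l') (section_good sec gG) nA aA (etrans (size_map _ _) sl') Al.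
move=> x hx; have hfx : ucs c (f x) by apply: hA; exists x.
rewrite mulSn; apply: cs_comp.
apply: (@cs_mono _ (derived i.+1 L) _ (full G) _ _ _ (IH (ltnW ltj))) => //.
elim: (c) x hfx {hx} => [|c' IHc] x h; first exact: (proj1 (ker x I) h).
by move=> g _; apply: IHc; rewrite (homR sK hf) //; apply: h.
Qed.

(** A commutator of a value on [l] and one on [l'] is a value of the next level on [l ++ l'], so the
    number of arguments doubles. The set of values is invariant under conjugation, which lets
    commutators of products be reduced to commutators of values. *)
Lemma derived_gen_values (G : grp) i : gsubset (derived i (full G))
  (gen (fun x => exists l : seq G, size l = 2 ^ i /\ derived i (glist l) x)).
Proof.
elim: i => [x _|i IH]; first by apply: gen_in; exists [:: x]; split=> //; apply: gen_in; left.
set V := fun x => exists l : seq G, size l = 2 ^ i.+1 /\ _.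
have nV : gnormal (gen V).
  apply: gnormal_gen => x g [l [sl hx]]; exists (map (fun y => gconj y g) l).
  rewrite size_map; split=> //.
  have hom : hom_on (full G) (fun y => gconj y g) by move=> a b _ _; apply: gconjM.
  have := img_derived (@sub_full G) hom (H := glist l) (fun _ _ => I) (sub_gen _) hx.
  apply: derived_mono => _ [z [hz <-]].
  have := img_gen (@sub_full G) hom (A := fun x => List.In x l) (fun _ _ => I) hz.
  by apply: gen_mono => _ [t [ht <-]]; apply: (List.in_map (fun y => gconj y g)).
apply: gen_min; first exact: gnormal_sub nV.
move=> _ [a [b [/IH ha [/IH hb ->]]]].
apply: (comm_gen nV _ ha hb) => {ha hb}a {}b [l [sl ha]] [l' [sl' hb]].
apply: gen_in; exists (l ++ l'); split; first by rewrite size_cat sl sl' addnn -mul2n expnS.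
apply: gen_in; exists a, b; split; [|split] => //.
  by apply: derived_mono ha; apply: gen_mono => t ht; apply/List.in_or_app; left.
by apply: derived_mono hb; apply: gen_mono => t ht; apply/List.in_or_app; right.
Qed.

(** The subgroup [derived s (ncl (glist l))] is normal in [G], lies in [glist l] by goodness, and
    contains all values of level [s] on [l]. *)
Lemma good_soluble s e : exists t, forall G, good s e G -> soluble_le (full G) t.
Proof.
have [N hN] := good_normal_in_list_ucs s e (2 ^ s).
exists (N + s) => G gG x; rewrite derivedD; apply: derived_ucs => {}x.
move/derived_gen_values; apply: gen_min; first exact: gnormal_sub (gnormal_ucs _ _).
move=> {}x [l [sl hx]].
apply: (hN G (derived s (ncl (glist l))) l gG _ sl).
- by apply: gnormal_derived; apply: gnormal_ncl.
- by case: gG => h _; apply: h; apply: sub_gen.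
- by apply: derived_mono hx; apply: ncl_sub.
Qed.

(* The solubility half of Roseblade's theorem. *)
Theorem all_subnormal_soluble n : exists t, solubility_bound n t.
Proof.
elim: n => [|n [t IH]].
  exists 0 => G h x _; have [c [c0 [cn _]]] := h _ (@sub_triv G).
  exact/c0.
have [t' ht'] := good_soluble (n * t) n.+2.
by exists t' => G hG; apply: ht'; apply: all_subnormal_good.
Qed.

(** * Finiteness of minimal insoluble groups *)

Lemma mem_In (T : eqType) (x : T) s : x \in s -> List.In x s.
Proof. by elim: s => //= y s IH; rewrite inE => /orP [/eqP ->|/IH]; [left | right]. Qed.

Lemma derived_finite_support (G : grp) i (H : G -> Prop) x : derived i H x ->
  exists l : seq G, (forall y, List.In y l -> H y) /\ derived i (glist l) x.
Proof.
have inl (l l' : seq G) y : glist l y -> glist (l ++ l') y.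
  by apply: gen_mono => t ht; apply/List.in_or_app; left.
have inr (l l' : seq G) y : glist l' y -> glist (l ++ l') y.
  by apply: gen_mono => t ht; apply/List.in_or_app; right.
have app (P : G -> Prop) (l l' : seq G) : (forall y, List.In y l -> P y) ->
  (forall y, List.In y l' -> P y) -> forall y, List.In y (l ++ l') -> P y.
  by move=> h h' y /(List.in_app_or _ _ _) [/h|/h'].
elim: i x => [|i IH] x /=.
  move=> hx; exists [:: x]; split=> [y [<-|[]]//|].
  by apply: gen_in; left.
elim=> [_ [a [b [/IH [l [hl ha]] [/IH [l' [hl' hb]] ->]]]]||
  y z _ [l [hl hy]] _ [l' [hl' hz]]|y _ [l [hl hy]]].
- exists (l ++ l'); split; first exact: app.
  apply: gen_in; exists a, b; split; last split=> //.
    by apply: derived_mono ha => t; apply: inl.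
  by apply: derived_mono hb => t; apply: inr.
- by exists nil; split=> //; apply: gen_one.
- exists (l ++ l'); split; first exact: app.
  apply: gen_mul.
    by apply: (derived_mono (i := i.+1)) hy => t; apply: inl.
  by apply: (derived_mono (i := i.+1)) hz => t; apply: inr.
by exists l; split=> //; apply: gen_inv.
Qed.

Definition perfect (G : grp) (R : G -> Prop) := gsubset R (derived 1 R).

Lemma perfect_derived (G : grp) (R : G -> Prop) i : perfect R -> gsubset R (derived i R).
Proof.
move=> h; elim: i => // i IH x /h.
by apply: (derived_mono (i := 1)).
Qed.

(** The quotient of [R] by [N] is an image of [H], hence soluble, and it is perfect, hence
    trivial. *)
Lemma perfect_supplement (G : grp) (R N H : G -> Prop) d : perfect R -> normal_in N R ->
  is_subgroup H -> gsubset H R -> soluble_le H d ->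
  gsubset R (gen (fun x => N x \/ H x)) -> gsubset R N.
Proof.
move=> pR nN sH HR sol RNH.
have [Q [f sec]] := section_exists nN.
case: (sec) => sR sN NR [hf surj ker].
suff: gsubset (derived d R) N by move=> h x /(perfect_derived d pR) /h.
apply/(section_soluble sec) => y dy.
have [z [dz <-]] : img f (derived d H) y.
  apply: (derived_img sR hf) => //; apply: derived_mono dy => {}y _.
  have [x [rx <-]] := surj y.
  have := @img_gen _ _ R f sR hf (fun x => N x \/ H x) _ x (RNH x rx).
  move=> hh; apply: (gen_min _ _ (hh _)) => [|_ [t [[nt|ht] <-]]|t [/NR|/HR] //].
  - exact: (sub_img sR hf).
  - by exists (gone G); rewrite (hom1 sR hf) (proj2 (ker t (NR _ nt)) nt); split=> //; apply: sub1.
  - by exists t.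
by rewrite (sol _ dz) (hom1 sR hf).
Qed.

Definition fin_index (G : grp) (A : G -> Prop) :=
  exists T : seq G, forall x, exists t, List.In t T /\ A (ginv t *g x).

Lemma fin_index_finite (G : grp) (A : G -> Prop) : fin_index A -> finite_set A ->
  finite_set (full G).
Proof.
move=> [T hT] [L hL]; exists (List.map (fun p => p.1 *g p.2) (List.list_prod T L)) => x _.
have [t [ht ha]] := hT x; apply/List.in_map_iff; exists (t, ginv t *g x).
by rewrite /= gmulVKr; split=> //; apply/List.in_prod_iff; split=> //; apply: hL.
Qed.

(* Schreier's lemma *)
Lemma fin_index_fg (G : grp) (A : G -> Prop) (l : seq G) : is_subgroup A ->
  (forall x, glist l x) -> fin_index A -> exists l', forall x, A x <-> glist l' x.
Proof.
move=> sA hl [T0 hT0]; pose T := gone G :: T0.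
have hT x : exists t, List.In t T /\ A (ginv t *g x).
  by have [t [ht h]] := hT0 x; exists t; split=> //; right.
(* The entry [gone G] matters at the end: with [t2 = x = gone G], every [t] of [T] that lies in [A]
   is itself in [Y]. *)
pose X := gone G :: l ++ map (@ginv G) l.
pose w (p : G * G * G) := ginv p.1.1 *g (p.1.2 *g p.2).
pose y p := if excluded_middle_informative (A (w p)) then w p else gone G.
pose Y := List.map y (List.list_prod (List.list_prod T X) T).
have inY t2 x t1 : List.In t2 T -> List.In x X -> List.In t1 T ->
    A (ginv t2 *g (x *g t1)) -> glist Y (ginv t2 *g (x *g t1)).
  move=> h2 hx h1 ha; apply: gen_in; apply/List.in_map_iff; exists (t2, x, t1).
  split; first by rewrite /y; case: excluded_middle_informative.
  by apply/List.in_prod_iff; split=> //; apply/List.in_prod_iff.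
have YA : gsubset (glist Y) A.
  apply: gen_min => // _ /List.in_map_iff [p [<- _]]; rewrite /y.
  by case: excluded_middle_informative => [h|h] //=; apply: sub1.
pose C g := exists t z, List.In t T /\ glist Y z /\ g = t *g z.
have stepX x g : List.In x X -> C g -> C (x *g g).
  move=> hx [t [z [ht [hz ->]]]]; have [t2 [h2 a2]] := hT (x *g t).
  exists t2, ((ginv t2 *g (x *g t)) *g z); split=> //; split; last by gsolve.
  by apply: gen_mul => //; apply: inY.
have sP : is_subgroup (fun h => (forall g, C g -> C (h *g g)) /\
    (forall g, C g -> C (ginv h *g g))).
  split; first by split=> g; rewrite ?ginv1 gmul1.
  split=> [a b [ha ha'] [hb hb']|a [ha ha']]; last by split=> // g; rewrite ginvK; apply: ha.
  split=> g hg; first by rewrite -gmulA; apply/ha/hb.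
  by rewrite ginvM -gmulA; apply/hb'/ha'.
have Call g : C g.
  have [|h _] := gen_min sP _ (hl g).
    move=> x hx; split=> k; apply: stepX; right; apply/List.in_or_app; [by left|right].
    exact: List.in_map.
  rewrite -(gmul1r g); apply: h; exists (gone G), (gone G).
  by rewrite gmul1; split; [left | split=> //; apply: gen_one].
exists Y => x; split=> [ax|/YA //]; have [t [z [ht [hz e]]]] := Call x.
rewrite e; apply: gen_mul => //.
have at_ : A t by apply/(subMr t sA (YA _ hz)); rewrite -e.
have := inY (gone G) (gone G) t; rewrite ginv1 !gmul1; apply=> //; by left.
Qed.

Lemma finite_cyclic_ext (G : grp) (P : G -> Prop) a D : is_subgroup P -> finite_set P ->
  P (zp a D) -> D <> 0%Z -> finite_set (fun x => exists c k, P c /\ x = c *g zp a k).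
Proof.
move=> sP [L hL] hD D0.
exists (List.map (fun p => p.1 *g zp a (Z.of_nat p.2))
  (List.list_prod L (iota 0 (Z.to_nat (Z.abs D))))).
move=> _ [c [k [hc ->]]]; apply/List.in_map_iff.
pose k' := Z.to_nat (k mod (Z.abs D)).
have [b1 b2] := Z.mod_pos_bound k (Z.abs D) ltac:(lia).
have [m hm] : exists m, k = (D * m + Z.of_nat k')%Z.
  have e := Z.div_mod k (Z.abs D) ltac:(lia).
  have [h|h] : (0 <= D)%Z \/ (D < 0)%Z by lia.
    by exists (k / Z.abs D)%Z; rewrite /k'; nia.
  by exists (- (k / Z.abs D))%Z; rewrite /k'; nia.
exists (c *g zp (zp a D) m, k'); split=> /=; first by rewrite hm zpD zpM gmulA.
apply/List.in_prod_iff; split; first by apply: hL; apply: subM => //; apply: sub_zp.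
have lt : k' < Z.to_nat (Z.abs D) by rewrite /k'; lia.
by apply: mem_In; rewrite mem_iota.
Qed.

Lemma glist_cons_form (G : grp) (a : G) l : abel (glist (a :: l)) ->
  forall x, glist (a :: l) x -> exists c k, glist l c /\ x = c *g zp a k.
Proof.
move=> ab x hx; have aa : glist (a :: l) a by apply: gen_in; left.
have lc c : glist l c -> glist (a :: l) c by apply: gen_mono => t ht; right.
have nrm g : glist (a :: l) g -> forall p, glist l p -> glist l (gconj p g).
  by move=> hg p hp; rewrite /gconj (ab _ _ (lc _ hp) hg) gmulKr.
apply/(coset_form (sub_gen _) (nrm a aa) (nrm _ (gen_inv aa))).
apply: gen_mono hx => t [<-|ht]; [by right | left; exact: gen_in].
Qed.

Lemma fg_abelian_exponent_finite (G : grp) (l : seq G) D : abel (glist l) -> D <> 0%Z ->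
  (forall x, glist l x -> zp x D = gone G) -> finite_set (glist l).
Proof.
move=> + D0; elim: l => [|a l IH] ab h.
  by exists [:: gone G] => x hx; left; apply/esym; apply: (gen_min (@sub_triv G) _ hx).
have lc c : glist l c -> glist (a :: l) c by apply: gen_mono => t ht; right.
have fl : finite_set (glist l).
  by apply: IH => [x y /lc hx /lc hy|x /lc]; [apply: ab | apply: h].
have [|L hL] := @finite_cyclic_ext _ _ a D (sub_gen _) fl _ D0.
  by rewrite h; [apply: gen_one | apply: gen_in; left].
by exists L => x /(glist_cons_form ab); apply: hL.
Qed.

(** A [p]-th root of [a] has the form [c1 a^z] with [c1] in [glist l], so the exponent [1 - z * p]
    takes [a], and then the whole group, into [glist l]; it is nonzero as [p > 1]. Moreover
    [glist l] stays [p]-divisible: if [x = t^p] then [t = t^(1 - z p) x^z]. *)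
Lemma fg_abelian_divisible_finite (G : grp) (l : seq G) p : abel (glist l) -> (1 < p)%Z ->
  (forall x, glist l x -> exists y, glist l y /\ x = zp y p) -> finite_set (glist l).
Proof.
move=> + p1; elim: l => [|a l IH] ab h.
  by exists [:: gone G] => x hx; left; apply/esym; apply: (gen_min (@sub_triv G) _ hx).
have lc c : glist l c -> glist (a :: l) c by apply: gen_mono => t ht; right.
have sl := sub_gen (fun x => List.In x l).
have aa : glist (a :: l) a by apply: gen_in; left.
have zc k : glist (a :: l) (zp a k) by apply: sub_zp => //; apply: sub_gen.
have [y [hy ay]] := h a aa.
have [c1 [z [hc1 ey]]] := glist_cons_form ab hy.
have hD : glist l (zp a (1 - z * p)).
  rewrite /Z.sub zpD zp1 zpN zpM {1}ay {1}ey zp_mulC; last by apply: ab => //; apply: lc.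
  by rewrite -gmulA gmulVr gmul1r; apply: sub_zp.
have D0 : (1 - z * p)%Z <> 0%Z.
  move=> e; have [||] := Z.divide_1_r p; first by exists z; lia.
    by lia.
  by lia.
have fl : finite_set (glist l).
  apply: IH => [x t /lc hx /lc ht|x hx]; first exact: ab.
  have [t [ht xt]] := h x (lc _ hx); exists t; split=> //.
  have [c [k [hc et]]] := glist_cons_form ab ht.
  have -> : t = zp t (1 - z * p) *g zp x z.
    rewrite xt -zpM -zpD (Z.mul_comm p).
    by rewrite Z.sub_add zp1.
  apply: subM => //; last exact: sub_zp.
  rewrite et zp_mulC; last by apply: ab => //; apply: lc.
  apply: subM => //; first exact: sub_zp.
  by rewrite -zpM Z.mul_comm zpM; apply: sub_zp.
have [L hL] := finite_cyclic_ext sl fl hD D0.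
by exists L => x /(glist_cons_form ab); apply: hL.
Qed.

(** Cayley's regular representation on the positions of the list [L]. As [L] may repeat elements,
    each [x] owns one position [io x], and all other positions are fixed. *)
Lemma finite_grp_embed (Q : grp) : finite_set (full Q) ->
  exists (gT : finGroupType) (f : Q -> gT),
    (forall x y, f (x *g y) = (f x * f y)%g) /\ injective f.
Proof.
move=> [L hL].
have hi x : exists i : 'I_(size L), nth (gone Q) L i = x.
  suff [i lt e] : exists2 i, i < size L & nth (gone Q) L i = x by exists (Ordinal lt).
  elim: (L) (hL x I) => //= a L' IH [->|/IH [i lt e]]; first by exists 0.
  by exists i.+1.
pose io x := proj1_sig (constructive_indefinite_description _ (hi x)).
have ioK : cancel io (fun i : 'I_(size L) => nth (gone Q) L i).
  by move=> x; rewrite /io; case: constructive_indefinite_description.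
have io_inj := can_inj ioK.
pose s g (i : 'I_(size L)) :=
  if i == io (nth (gone Q) L i) then io (nth (gone Q) L i *g g) else i.
have sE g x : s g (io x) = io (x *g g) by rewrite /s ioK eqxx.
have sM g h i : s h (s g i) = s (g *g h) i.
  case: (classic (exists x, i = io x)) => [[x ->]|ne]; first by rewrite !sE gmulA.
  have nf : (i == io (nth (gone Q) L i)) = false.
    by apply/eqP => e; apply: ne; exists (nth (gone Q) L i).
  by rewrite /s !nf.
have s1 i : s (gone Q) i = i.
  by rewrite /s; case: eqP => // e; rewrite gmul1r -e.
have s_inj g : injective (s g).
  by apply: (can_inj (g := s (ginv g))) => i; rewrite sM gmulVr s1.
exists {perm 'I_(size L)}, (fun g => perm (@s_inj g)); split=> [g h|g h /permP e].
  by apply/permP => i; rewrite permM !permE sM.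
apply: io_inj; have := e (io (gone Q)).
by rewrite !permE !sE !gmul1.
Qed.

(** * Homomorphisms into finite groups *)

Section FiniteImages.
Variables (G : grp) (K : G -> Prop) (gT : finGroupType) (f : G -> gT).
Hypotheses (sK : is_subgroup K)
  (hf : forall x y, K x -> K y -> f (x *g y) = (f x * f y)%g).

Lemma fhom1 : f (gone G) = 1%g.
Proof.
have k1 := sub1 sK; apply: (@mulgI _ (f (gone G))).
by rewrite -hf // gmul1 mulg1.
Qed.

Lemma fhomV x : K x -> f (ginv x) = (f x)^-1%g.
Proof.
move=> kx; apply: (@mulgI _ (f x)); rewrite mulgV -hf //; last exact: subV.
by rewrite gmulVr fhom1.
Qed.

Lemma fhomJ x y : K x -> K y -> f (gconj x y) = (f x ^ f y)%g.
Proof.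
move=> kx ky; rewrite /gconj hf ?hf ?fhomV ?conjgE //; [exact: subV | exact: subM].
Qed.

Lemma fhomR x y : K x -> K y -> f (gcomm x y) = [~ f x, f y]%g.
Proof.
move=> kx ky; rewrite /gcomm hf ?fhomV ?fhomJ //; [exact: subV | exact: subJ].
Qed.

Lemma fimg_group (H : G -> Prop) : is_subgroup H -> gsubset H K ->
  exists Hf : {group gT}, forall y, y \in Hf <-> exists x, H x /\ f x = y.
Proof.
move=> sH HK.
pose A := [set y | is_left (excluded_middle_informative (exists x, H x /\ f x = y))].
have inA y : y \in A <-> exists x, H x /\ f x = y.
  by rewrite inE; case: excluded_middle_informative.
have gA : group_set A.
  apply/group_setP; split.
    by apply/inA; exists (gone G); rewrite fhom1; split=> //; apply: sub1.
  move=> _ _ /inA [x [hx <-]] /inA [y [hy <-]]; apply/inA; exists (x *g y).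
  by rewrite hf; try exact: HK; split=> //; apply: subM.
by exists (Group gA).
Qed.

Lemma sub_fpreim (Hf : {group gT}) : is_subgroup (fun x => K x /\ f x \in Hf).
Proof.
split; first by rewrite fhom1 group1; split=> //; apply: sub1.
split=> [x y [kx hx] [ky hy]|x [kx hx]].
  by rewrite hf // groupM //; split=> //; apply: subM.
by rewrite fhomV // groupV; split=> //; apply: subV.
Qed.

Lemma fimg_solvable (H : G -> Prop) (Hf : {group gT}) d : is_subgroup H -> gsubset H K ->
  soluble_le H d -> (forall y, y \in Hf -> exists x, H x /\ f x = y) -> solvable Hf.
Proof.
move=> sH HK sol surj; apply/derivedP; exists d; apply/trivgP.
suff h i y : y \in Hf^`(i)%g -> exists x, derived i H x /\ f x = y.
  by apply/subsetP => y /h [x [/sol -> <-]]; rewrite fhom1 group1.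
elim: i y => [|i IH] y; first exact: surj.
have dK x : derived i H x -> K x by move/(derived_sub sH)/HK.
have sD := sub_derived i.+1 sH.
have DK : gsubset (derived i.+1 H) K by move=> x /(derived_sub sH)/HK.
have [D inD] := fimg_group sD DK.
suff: (Hf^`(i.+1))%g \subset D by move/subsetP => h /h /inD.
rewrite dergSn gen_subG; apply/subsetP => _ /imset2P [a b /IH [x [hx <-]] /IH [z [hz <-]] ->].
apply/inD; exists (gcomm x z); split; last by rewrite fhomR //; apply: dK.
by apply: gen_in; exists x, z.
Qed.

End FiniteImages.

Lemma zp_fhom (G : grp) (gT : finGroupType) (f : G -> gT) x n :
  (forall x y, f (x *g y) = (f x * f y)%g) -> f (zp x (Z.of_nat n)) = (f x ^+ n)%g.
Proof.
move=> hf; rewrite zp_nat; elim: n => [|n IH] /=.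
  by rewrite (@fhom1 G (full G) gT f (@sub_full G)) // => *; apply: hf.
by rewrite hf IH expgS.
Qed.

(* For a prime p larger than the index, Schur-Zassenhaus complements A / A^p, and the
   complement must be everything; hence A = A^p. *)
Lemma finite_of_abelian_fin_index (Q : grp) (A : Q -> Prop) (l : seq Q) :
  (forall x, glist l x) -> perfect (full Q) ->
  (forall H, is_subgroup H -> gsubset (full Q) H \/ exists j, soluble_le H j) ->
  gnormal A -> abel A -> (exists x, ~ A x) -> fin_index A -> finite_set (full Q).
Proof.
move=> hl pQ dich nA aA [x0 nx0] fiA; have sA := gnormal_sub nA.
have [l' hl'] := fin_index_fg sA hl fiA.
have aA' : abel (glist l') by move=> x y /hl' hx /hl' hy; apply: aA.
have [T hT] := fiA.
have [p ltp pp] := prime_above (size T).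
have p0 : Z.of_nat p <> 0%Z by have := prime_gt0 pp; lia.
apply: (fin_index_finite fiA).
(* By Schreier's lemma [A] is finitely generated, and a [p]-divisible finitely generated abelian
   group is finite. *)
suff hdiv x : A x -> exists y, A y /\ x = zp y (Z.of_nat p).
  have p1 : (1 < Z.of_nat p)%Z by have := prime_gt1 pp; lia.
  have [|L hL] := fg_abelian_divisible_finite aA' p1.
    by move=> x /hl' /hdiv [y [/hl' hy e]]; exists y.
  by exists L => x /hl'; apply: hL.
pose W x := exists y, A y /\ x = zp y (Z.of_nat p).
rewrite -/(W x) => ax.
have nW : gnormal W.
  split.
    split; first by exists (gone Q); rewrite zp_one; split=> //; apply: sub1.
    split=> [_ _ [y [ay ->]] [z [az ->]]|_ [y [ay ->]]].
      by exists (y *g z); rewrite zp_mulC; [split=> //; apply: subM | apply: aA].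
    by exists (ginv y); rewrite -!zpN1 -!zpM Z.mul_comm; split=> //; apply: sub_zp.
  move=> _ g [y [ay ->]] _; exists (gconj y g); rewrite zp_conj; split=> //.
  exact: gnormalJ.
have WA : gsubset W A by move=> _ [y [ay ->]]; apply: sub_zp.
have [Q' [f sec]] := quotient_exists nW.
case: (sec) => sK _ _ [hf surj ker].
set A' := img f A.
have sA' : is_subgroup A' by apply: (sub_img sK hf).
have fA' : finite_set A'.
  have gA' y : A' y <-> glist (map f l') y.
    split=> [[z [/hl' hz <-]]|hy].
      have := @img_gen _ _ (full Q) f sK hf (fun x => List.In x l') (fun _ _ => I) z hz.
      by apply: gen_mono => _ [t [ht <-]]; apply: List.in_map.
    apply: (gen_min sA' _ hy) => _ /List.in_map_iff [t [<- ht]].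
    by exists t; split=> //; apply/hl'; apply: gen_in.
  have aA1 : abel (glist (map f l')).
    move=> _ _ /gA' [a [ha <-]] /gA' [b [hb <-]].
    by rewrite -!hf // (aA _ _ ha hb).
  have [|L hL] := fg_abelian_exponent_finite aA1 p0.
    move=> _ /gA' [a [ha <-]].
    have -> : zp (f a) (Z.of_nat p) = f (zp a (Z.of_nat p)).
      rewrite !zp_nat; elim: (p) => [|m IH] /=; first by rewrite (hom1 sK hf).
      by rewrite hf // IH.
    by apply/ker => //; exists a.
  by exists L => y /gA'; apply: hL.
have fiA' : fin_index A'.
  exists (map f T) => y; have [z [_ <-]] := surj y; have [t [ht h]] := hT z.
  exists (f t); split; first exact: List.in_map.
  exists (ginv t *g z); split=> //.
  by rewrite hf // (homV sK hf).
have [gT [psi [psiM psi_inj]]] := finite_grp_embed (fin_index_finite fiA' fA').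
pose th x := psi (f x).
have thM u v : full Q u -> full Q v -> th (u *g v) = (th u * th v)%g.
  by move=> _ _; rewrite /th hf // psiM.
have th1 z : th z = 1%g <-> W z.
  rewrite -(fhom1 sK thM) /th; split=> [/psi_inj e|wx].
    by apply/ker => //; rewrite e (hom1 sK hf).
  by rewrite (proj2 (ker z I) wx) (hom1 sK hf).
have [Qf inQ] := fimg_group sK thM sK (fun _ _ => I).
have [Af inA] := fimg_group sK thM sA (fun _ _ => I).
have thQ y : th y \in Qf by apply/inQ; exists y.
have subAQ : Af \subset Qf by apply/subsetP => _ /inA [y [_ <-]].
have nAQ : (Af <| Qf)%g.
  apply/andP; split=> //; apply/subsetP => _ /inQ [g [_ <-]]; rewrite inE.
  apply/subsetP => _ /imsetP [_ /inA [a [ha <-]] ->]; apply/inA.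
  by exists (gconj a g); rewrite (fhomJ sK thM) //; split=> //; apply: gnormalJ.
have pA : (p.-group Af)%g.
  rewrite -pnat_exponent; apply: (@pnat_dvd _ p); last by rewrite pnat_id.
  apply/exponentP => _ /inA [a [ha <-]].
  rewrite -(@zp_fhom Q gT th) => [|*]; last exact: thM.
  by apply/th1; exists a.
have lti : #|Qf : Af|%g < p.
  apply: leq_ltn_trans ltp; rewrite -(size_map (fun t => (th t *: Af)%g) T).
  rewrite -card_lcosets; apply: leq_trans (card_size _).
  apply: subset_leq_card; apply/subsetP => _ /lcosetsP [_ /inQ [z [_ <-]] ->].
  have [t [ht h]] := hT z.
  have -> : (th z *: Af = th t *: Af)%g.
    apply/lcoset_eqP; rewrite mem_lcoset; apply/inA; exists (ginv t *g z).
    by split=> //; rewrite thM // (fhomV sK thM).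
  elim: (T) ht => //= u T' IH [->|/IH]; rewrite inE ?eqxx // => ->.
  by rewrite orbT.
have hall : Hall Qf Af.
  rewrite /Hall subAQ /=; apply: (@pnat_coprime p) => //.
  rewrite p'natE //; apply/negP => /dvdn_leq; rewrite indexg_gt0 => /(_ isT).
  by rewrite leqNgt lti.
have /splitsP [Kf /complP [KA1 KAQ]] := SchurZassenhaus_split hall nAQ.
have sP := sub_fpreim sK thM Kf.
(* If the preimage of the complement is everything, then [Af] meets its complement in all of [Af]
   and is trivial, so [x] is in [W]. If it is soluble, it supplements [A], and perfectness forces
   [A] to be the whole group. *)
case: (dich _ sP) => [all|[j sol]].
  apply/th1; apply/set1P; rewrite -[[set 1%g]]/(1%g : {set gT}) -KA1 inE.
  by rewrite (proj2 (all x I)) andbT; apply/inA; exists x.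
case: nx0; apply: (perfect_supplement pQ (gnormal_inE nA) sP _ sol) => // y _.
have : th y \in (Af * Kf)%g by rewrite KAQ.
case/mulsgP => _ k /inA [a [ha <-]] hk e.
have hay : th (ginv a *g y) = k by rewrite thM // (fhomV sK thM) // e mulKg.
rewrite -(gmulVKr a y); apply: gen_mul; apply: gen_in; [by left | right].
by split=> //; rewrite hay.
Qed.

(** Modulo the last nontrivial derived term [A] of [N] the group is finite by induction; so [A] has
    finite index, and the abelian case applies. *)
Lemma finite_of_soluble_fin_index i (Q : grp) (N : Q -> Prop) (l : seq Q) :
  (forall x, glist l x) -> perfect (full Q) ->
  (forall H, is_subgroup H -> gsubset (full Q) H \/ exists j, soluble_le H j) ->
  gnormal N -> soluble_le N i -> (exists x, ~ N x) -> fin_index N -> finite_set (full Q).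
Proof.
elim: i Q N l => [|i IH] Q N l hl pQ dich nN sol prop fiN.
  apply: (fin_index_finite fiN); exists [:: gone Q] => x /sol ->; by left.
have sN := gnormal_sub nN.
set A := derived i N.
have nA : gnormal A := gnormal_derived i nN.
have AN : gsubset A N by apply: derived_sub.
have [Q' [f sec]] := quotient_exists nA.
case: (sec) => sK _ _ [hf surj ker].
have nN' : gnormal (img f N).
  split; first by apply: (sub_img sK hf).
  move=> _ y [x [hx <-]] _; have [g [_ <-]] := surj y.
  by exists (gconj x g); rewrite (homJ sK hf) //; split=> //; apply: gnormalJ.
have fin : finite_set (full Q').
  apply: (IH Q' (img f N) (map f l)) => //.
  - exact: (section_gen sec).
  - move=> y _; have [x [_ <-]] := surj y.
    by apply: (section_derived sec); apply: pQ.
  - move=> H sH; have sP := sub_preim sK hf sH.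
    case: (dich _ sP) => [h|[j h]]; [left=> y _ | right; exists j => y dy].
      by have [x [_ <-]] := surj y; case: (h x I).
    have [x [/h -> <-]] : img f (derived j (fun x => full Q x /\ H (f x))) y.
      apply: (derived_img sK hf) => //; apply: derived_mono dy => z hz.
      by have [t [_ e]] := surj z; exists t; rewrite e.
    exact: (hom1 sK hf).
  - move=> y /(derived_img sK hf (H := N) (fun _ _ => I) sN) [x [dx <-]].
    exact/ker.
  - case: prop => x nx; exists (f x) => -[z [hz e]]; apply: nx.
    exact: (section_inj_preim sec sN AN I I e).
  - case: fiN => T hT; exists (map f T) => y.
    have [z [_ <-]] := surj y; have [t [ht h]] := hT z.
    exists (f t); split; first exact: List.in_map.
    by exists (ginv t *g z); split=> //; rewrite hf // (homV sK hf).
apply: (finite_of_abelian_fin_index hl pQ dich nA).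
- by move=> a b ha hb; apply/gcomm_eq1; apply: sol; apply: gen_in; exists a, b.
- by case: prop => x nx; exists x => /AN.
case: fin => L hL; have [y _|T [eT _]] := @lift_list _ _ f (full Q) L.
  by have [x [_ e]] := surj y; exists x.
exists T => x; have := hL (f x) I; rewrite -eT => /List.in_map_iff [t [e ht]].
by exists t; split=> //; apply: (section_eq sec).
Qed.

(** * Almost minimal simple quotients *)

(** Unlike in [all_subnormal_good], the top factor of the closure series is controlled too: its
    subgroups correspond to subgroups above [H]. So all [n] factors count. *)
Lemma residual_dichotomy (G : grp) n d t : solubility_bound n t ->
  (forall H : G -> Prop, is_subgroup H -> subnormal_le H n \/ soluble_le H d) ->
  forall H : G -> Prop, is_subgroup H ->
    gsubset (derived (n * t) (full G)) H \/ soluble_le H d.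
Proof.
move=> hb hG H sH; case: (classic (soluble_le H d)) => [|ns]; [by right | left].
have hM M : is_subgroup M -> gsubset H M -> subnormal_le M n.
  move=> sM HM; case: (hG M sM) => // sol; case: ns => x dx.
  by apply: sol; apply: derived_mono dx.
have := @ncs_derived G H n t 0 (hM H sH (fun _ h => h)) (leq0n n); rewrite subn0; apply.
move=> i _; have [Q [f sec]] := section_exists (ncs_normal H i).
apply/(section_soluble sec); apply: hb.
apply: (section_all_subnormal sec) => M sM NM _.
have [|c [c0 [cn cN]]] := hM M sM; first by move=> x hx; apply: NM; apply: ncs_ge.
by exists c; split=> //; split=> // x _; apply: cn.
Qed.

(** * The perfect residual and its radical *)

Section MinimalInsoluble.
Variables (G : grp) (R : G -> Prop) (d : nat).
Hypotheses (nR : gnormal R) (pR : perfect R) (nsol : ~ soluble_le R d).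
Hypothesis dich : forall H : G -> Prop, is_subgroup H -> gsubset R H \/ soluble_le H d.
Let sR := gnormal_sub nR.

(** A nontrivial element of [derived d R] already arises from finitely many elements of [R]; the
    subgroup they generate is not soluble of length [d], so it contains [R]. *)
Lemma minimal_insoluble_fg : exists l, forall x, R x <-> glist l x.
Proof.
have [x [dx x1]] : exists x, derived d R x /\ x <> gone G.
  by apply: NNPP => h; apply: nsol => x dx; apply: NNPP => x1; apply: h; exists x.
have [l [lR dl]] := derived_finite_support dx.
exists l => y; split; last exact: gen_min.
by case: (dich (sub_gen (fun x => List.In x l))) => [h|h]; [apply: h | case: x1; apply: h].
Qed.

Lemma minimal_insoluble_finite : locally_graded G -> finite_set R.
Proof.
move=> lg; have [l hl] := minimal_insoluble_fg.
have el : R = glist l by apply: pred_ext.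
have [|gT [phi [phiM [x0 [hx0 px0]]]]] := lg l.
  apply: NNPP => h; apply: nsol => x /(derived_sub sR) /hl hx.
  by apply: NNPP => x1; apply: h; exists x.
rewrite -/(glist l) -el in phiM hx0.
have [Q [f sec]] := subgrp_exists sR.
case: (sec) => _ _ _ [hf surj ker].
pose N x := R x /\ phi x = 1%g.
have sN : is_subgroup N.
  apply: sub_ext (sub_fpreim sR phiM 1%G) => x.
  by rewrite /N; split=> [[rx /set1P]|[rx ->]] //; rewrite group1.
have NR : gsubset N R by move=> x [].
have RQ (H : Q -> Prop) i : is_subgroup H ->
    soluble_le (fun x => R x /\ H (f x)) i -> soluble_le H i.
  move=> sH h y dy.
  have [x [/h -> <-]] : img f (derived i (fun x => R x /\ H (f x))) y.
    apply: (derived_img sR hf) => //; first by move=> x [].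
      exact: sub_preim.
    apply: derived_mono dy => z hz.
    by have [t [rt e]] := surj z; exists t; rewrite e.
  exact: (hom1 sR hf).
have finQ : finite_set (full Q).
  apply: (@finite_of_soluble_fin_index d Q (img f N) (map f l)).
  - by apply: (section_gen sec) => x hx; apply/hl => //; apply: gen_in.
  - by move=> y _; have [x [rx <-]] := surj y; apply: (section_derived sec); apply: pR.
  - move=> H sH; case: (dich (sub_preim sR hf sH)) => h.
      by left=> y _; have [x [rx <-]] := surj y; case: (h x rx).
    by right; exists d; apply: RQ.
  - split; first exact: (sub_img sR hf).
    move=> _ y [x [[rx px] <-]] _; have [g [rg <-]] := surj y.
    exists (gconj x g); rewrite (homJ sR hf) //; split=> //; split; first exact: subJ.
    by rewrite (fhomJ sR phiM) // px conj1g.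
  - case: (dich sN) => h.
      by case: px0; case: (h x0 hx0).
    move=> y /(derived_img sR hf NR sN) [x [/h -> <-]]; exact: (hom1 sR hf).
  - exists (f x0) => -[z [[rz pz] e]]; apply: px0.
    have := section_eq sec rz hx0 e.
    by move/(congr1 (gmul z)); rewrite gmulVKr gmul1r => ->.
  (* A transversal of the kernel indexed by the elements of [gT]; values that [phi] does not take on
     [R] receive [gone G]. *)
  have ch y : exists x, R x /\ ((exists z, R z /\ phi z = y) -> phi x = y).
    case: (classic (exists z, R z /\ phi z = y)) => [[z [rz e]]|h]; first by exists z.
    by exists (gone G); split; first exact: sub1.
  pose c y := proj1_sig (constructive_indefinite_description _ (ch y)).
  have hc y : R (c y) /\ ((exists z, R z /\ phi z = y) -> phi (c y) = y).
    by rewrite /c; case: constructive_indefinite_description.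
  exists (map (fun y => f (c y)) (enum gT)) => z; have [x [rx <-]] := surj z.
  have [rc pc] := hc (phi x); exists (f (c (phi x))); split.
    by apply: (List.in_map (fun y => f (c y))); apply: mem_In; rewrite mem_enum.
  have rV := subV sR rc.
  exists (ginv (c (phi x)) *g x); split; last by rewrite hf // (homV sR hf).
  split; first exact: subM.
  by rewrite phiM // (fhomV sR phiM) // pc ?mulVg //; exists x.
case: finQ => L hL; have [y _|T [eT hT]] := @lift_list _ _ f R L.
  by have [x [rx e]] := surj y; exists x.
exists T => x rx; have := hL (f x) I; rewrite -eT => /List.in_map_iff [t [e ht]].
have := section_eq sec (hT t ht) rx e.
by move/(congr1 (gmul t)); rewrite gmulVKr gmul1r => ->.
Qed.

Definition proper_normal N := normal_in N R /\ ~ gsubset R N.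

(** [N2] does not contain [R], so it is soluble; if [N1] and [N2] generated [R], then
    [perfect_supplement] would give [N1 = R]. *)
Lemma proper_normal_join N1 N2 : proper_normal N1 -> proper_normal N2 ->
  proper_normal (gen (fun x => N1 x \/ N2 x)).
Proof.
move=> [n1 p1] [n2 p2]; have [s1 [_ [N1R J1]]] := n1; have [s2 [_ [N2R J2]]] := n2.
split; last first.
  move=> h; apply: p1; case: (dich s2) => // sol.
  exact: (perfect_supplement pR n1 s2 N2R sol h).
split; first exact: sub_gen.
split=> //; split; first by apply: gen_min => // x [/N1R|/N2R].
move=> x k hx rk; apply: gen_conj hx => y [hy|hy]; [left; exact: J1 | right; exact: J2].
Qed.

Lemma proper_normal_triv : proper_normal (fun x => x = gone G).
Proof.
split; last by move=> h; apply: nsol => x /(derived_sub sR) /h.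
split; first exact: sub_triv.
by split=> //; split=> [x ->|x k -> _]; [apply: sub1 | apply: gconj1].
Qed.

(** A union, which is a subgroup because joins of proper normal subgroups stay proper. All these
    subgroups are soluble, so this is the soluble radical of [R]. *)
Definition radical x := exists N, proper_normal N /\ N x.

Lemma sub_radical : is_subgroup radical.
Proof.
split; first by exists (fun x => x = gone G); split=> //; apply: proper_normal_triv.
split=> [x y [N1 [p1 h1]] [N2 [p2 h2]]|x [N [p h]]]; last first.
  by exists N; split=> //; apply: subV => //; case: p => -[].
exists (gen (fun x => N1 x \/ N2 x)); split; first exact: proper_normal_join.
by apply: gen_mul; apply: gen_in; [left | right].
Qed.

Lemma radical_sub : gsubset radical R.
Proof. by move=> x [N [[[_ [_ [h _]]] _] /h]]. Qed.

Lemma gnormal_radical : gnormal radical.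
Proof.
split; first exact: sub_radical.
move=> x g [N [[[sN [_ [NR NJ]]] pN] nx]] _.
exists (fun y => N (gconj y (ginv g))); split; last by rewrite gconjK.
split; last first.
  move=> h; apply: pN => y ry; have := h (gconj y g) (gnormalJ _ nR ry).
  by rewrite gconjK.
split.
  split; first by rewrite gconj1; apply: sub1.
  by split=> [a b ha hb|a ha]; rewrite ?gconjM ?gconjV; [apply: subM | apply: subV].
split=> //; split=> [y /NR ry|y k hy rk].
  by rewrite -(gconjKV y g); apply: gnormalJ.
have -> : gconj (gconj y k) (ginv g) = gconj (gconj y (ginv g)) (gconj k (ginv g)) by gsolve.
by apply: NJ => //; apply: gnormalJ.
Qed.

(** Finitely many proper normal subgroups lie in a single one, and [R] is finitely generated. *)
Lemma radical_proper : ~ gsubset R radical.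
Proof.
move=> h; have [l hl] := minimal_insoluble_fg.
have [N [[[sN _] pN] lN]] : exists N, proper_normal N /\ forall x, List.In x l -> N x.
  have {hl}hR x : List.In x l -> R x by move=> hx; apply/hl; apply: gen_in.
  elim: (l) hR => [|a l' IH] hR.
    by exists (fun x => x = gone G); split=> //; apply: proper_normal_triv.
  have [|N [pN hN]] := IH; first by move=> x hx; apply: hR; right.
  have [N' [pN' ha]] := h a (hR a (or_introl erefl)).
  exists (gen (fun x => N x \/ N' x)); split; first exact: proper_normal_join.
  by move=> x [<-|/hN hx]; apply: gen_in; [right | left].
by apply: pN => x /hl; apply: gen_min.
Qed.

Lemma radical_max N : normal_in N R -> gsubset R N \/ gsubset N radical.
Proof.
move=> nN; case: (classic (gsubset R N)) => h; [by left | right=> x nx].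
by exists N.
Qed.

Lemma almost_minimal_simple_quotient : finite_set R ->
  exists S : G -> Prop, normal_in S (full G) /\ soluble_le S d /\ quotient_finite_ams S.
Proof.
move=> finR.
have sK := sub_radical; have nKG := gnormal_radical; set K := radical in sK nKG.
have nK : normal_in K R.
  by split=> //; split=> //; split=> [|x k hx _]; [apply: radical_sub | apply: gnormalJ].
have [Q [f sec]] := section_exists nK.
case: (sec) => _ _ KR [hf surj ker].
have finQ : finite_set (full Q).
  case: finR => L hL; exists (map f L) => y _; have [x [rx <-]] := surj y.
  by apply: List.in_map; apply: hL.
have [gT [psi [psiM psi_inj]]] := finite_grp_embed finQ.
pose th x := psi (f x).
have thM x y : R x -> R y -> th (x *g y) = (th x * th y)%g.
  by move=> rx ry; rewrite /th hf // psiM.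
have th1 x : R x -> (th x = 1%g <-> K x).
  move=> rx; rewrite -(fhom1 sR thM) /th; split=> [/psi_inj e|kx].
    by apply/ker => //; rewrite e (hom1 sR hf).
  by rewrite (proj2 (ker x rx) kx) (hom1 sR hf).
have th_eq x y : R x -> R y -> (th x = th y <-> K (ginv x *g y)).
  move=> rx ry; have rV := subV sR rx.
  rewrite -th1; last exact: subM.
  rewrite thM // (fhomV sR thM) //; split=> [->|e]; first by rewrite mulVg.
  by apply: (@mulgI _ (th x)^-1%g); rewrite e mulVg.
have [M inM] := fimg_group sR thM sR (fun _ h => h).
have simM : minimal_simple M.
  split; last split.
  - apply/simpleP; split.
      apply/eqP => e; apply: radical_proper => x rx; apply/th1 => //.
      by apply/set1P; rewrite -[[set 1%g]]/(1%g : {set gT}) -e; apply/inM; exists x.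
    move=> H nH; pose N x := R x /\ th x \in H.
    have nN : normal_in N R.
      split; first exact: sub_fpreim.
      split=> //; split=> [x []//|x k [rx hx] rk]; split; first exact: subJ.
      rewrite (fhomJ sR thM) // memJ_norm //.
      by apply: (subsetP (normal_norm nH)); apply/inM; exists k.
    case: (radical_max nN) => h; [right | left].
      apply/eqP; rewrite eqEsubset (normal_sub nH) /=.
      by apply/subsetP => _ /inM [x [rx <-]]; case: (h x rx).
    apply/trivgP/subsetP => y hy.
    have /inM [x [rx e]] := subsetP (normal_sub nH) y hy.
    by apply/set1P; rewrite -e; apply/th1 => //; apply: h; split; rewrite ?e.
  - apply/negP => /centsP ab; apply: radical_proper => x /pR.
    apply: gen_min => // _ [a [b [ra [rb ->]]]]; apply/th1; first exact: subR.
    rewrite (fhomR sR thM) //; apply/eqP/commgP.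
    by apply: ab; apply/inM; [exists a | exists b].
  move=> H /properP [HM [y /inM [x [rx e]] ny]].
  have sP := sub_fpreim sR thM H.
  case: (dich sP) => [h|sol].
    by case/negP: ny; rewrite -e; case: (h x rx).
  apply: (fimg_solvable sR thM sP _ sol) => [z []//|z hz].
  have /inM [t [rt et]] := subsetP HM z hz.
  by exists t; split=> //; split=> //; rewrite et.
have ex y : exists x, R x /\ (y \in M -> th x = y).
  case: (boolP (y \in M)) => [/inM [x [rx e]]|_]; first by exists x.
  by exists (gone G); split=> //; apply: sub1.
pose sg y := proj1_sig (constructive_indefinite_description _ (ex y)).
have hsg y : R (sg y) /\ (y \in M -> th (sg y) = y).
  by rewrite /sg; case: constructive_indefinite_description.
(* Elements of [Aut M] are permutations of the whole type [gT] that fix everything outside [M],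
   hence the value [y] there. *)
pose al g y := if y \in M then th (gconj (sg y) g) else y.
have RJ x g : R x -> R (gconj x g) by move=> rx; apply: gnormalJ.
have thM' x : R x -> th x \in M by move=> rx; apply/inM; exists x.
have alE g x : R x -> al g (th x) = th (gconj x g).
  move=> rx; rewrite /al thM' //; have [rs es] := hsg (th x).
  apply/th_eq; try exact: RJ.
  rewrite -gconjV -gconjM; apply: gnormalJ => //.
  by apply/th_eq => //; apply: es; apply: thM'.
have alN g y : y \notin M -> al g y = y by rewrite /al => /negbTE ->.
have al_comp g h y : al h (al g y) = al (g *g h) y.
  case: (boolP (y \in M)) => [/inM [x [rx <-]]|ny]; last by rewrite !alN.
  by rewrite !alE ?gconjJ //; apply: RJ.
have al1 y : al (gone G) y = y.
  case: (boolP (y \in M)) => [/inM [x [rx <-]]|ny]; last by rewrite !alN.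
  by rewrite alE // gconjg1.
have al_inj g : injective (al g).
  by apply: (can_inj (g := al (ginv g))) => y; rewrite al_comp gmulVr al1.
pose phi g := perm (@al_inj g).
have phiM x y : phi (x *g y) = (phi x * phi y)%g.
  by apply/permP => z; rewrite permM !permE al_comp.
have phiM' x y : full G x -> full G y -> phi (x *g y) = (phi x * phi y)%g by [].
have sF := @sub_full G.
have [X inX] := fimg_group sF phiM' sF (fun _ _ => I).
have XAut : X \subset Aut M.
  apply/subsetP => _ /inX [g [_ <-]]; rewrite inE; apply/andP; split.
    by apply/subsetP => y; rewrite !inE permE; apply: contraR => /alN ->.
  apply/morphicP => _ _ /inM [a [ra <-]] /inM [b [rb <-]]; rewrite !permE.
  by rewrite -thM // !alE //; [rewrite gconjM thM //; apply: RJ | apply: subM].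
have InnX : Inn M \subset X.
  apply/subsetP => _ /morphimP [z _ zM ->]; have /inM [g [rg eg]] := zM.
  apply/inX; exists g; split=> //; apply/permP => y; rewrite permE.
  case: (boolP (y \in M)) => yM.
    rewrite norm_conj_autE //; last exact: (subsetP (normG M)).
    by have /inM [x [rx <-]] := yM; rewrite alE // (fhomJ sR thM) // eg.
  rewrite alN //; apply/esym; apply: (out_Aut (Aut_aut _ _)).
  exact: yM.
pose S g := phi g = 1%g.
have nS : normal_in S (full G).
  split; last split=> //; last split=> //.
    apply: sub_ext (sub_fpreim sF phiM' 1%G) => x.
    by rewrite /S; split=> [[_ /set1P]|->] //; rewrite group1.
  by move=> h k hS _; rewrite /S (fhomJ sF phiM') // hS conj1g.
exists S; split=> //; split.
  (* If [S] contained [R], then [R] would act trivially on its quotient by [K]; that quotient would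
     be abelian, and the perfect group [R] would equal its radical. *)
  case: (dich (proj1 nS)) => // h; case: radical_proper => x /pR.
  apply: gen_min => // _ [a [b [ra [rb ->]]]]; apply/th_eq => //; first exact: RJ.
  rewrite -alE // -[al b (th a)](permE (@al_inj b)) -/(phi b).
  by rewrite (h b rb) perm1.
exists {perm gT}, X, phi; split=> //; split; first by move=> x; apply/inX; exists x.
split; first by move=> y /inX [x [_ e]]; exists x.
split=> //.
exists gT, M, X; split=> //; split=> //; split=> //.
exact: isog_refl.
Qed.

End MinimalInsoluble.

Theorem theorem1p2 :
  exists (f : nat -> nat -> nat) (g : nat -> nat),
    forall (G : grp) (n d : nat),
      0 < n -> 0 < d ->
      locally_graded G ->
      (forall H : G -> Prop, is_subgroup H ->
         subnormal_le H n \/ soluble_le H d) ->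
      soluble_le (full G) (f n d) \/
      (exists r, r <= g n /\ finite_set (derived r (full G)) /\
         exists S : G -> Prop,
           normal_in S (full G) /\ soluble_le S d /\ quotient_finite_ams S).
Proof.
pose t n := proj1_sig (constructive_indefinite_description _ (all_subnormal_soluble n)).
have ht n : solubility_bound n (t n).
  by rewrite /t; case: constructive_indefinite_description.
(* The summand [n * t n] reaches [R]; the further [d.+1] covers the case where only the derived
   subgroup of [R] is known to have length at most [d]. *)
exists (fun n d => d.+1 + n * t n), (fun n => n * t n) => G n d _ _ lg hG.
have dich := residual_dichotomy (ht n) hG.
set R := derived (n * t n) (full G) in dich.
have nR : gnormal R by apply: gnormal_derived; apply: gnormal_full.
have solR : soluble_le R d.+1 -> soluble_le (full G) (d.+1 + n * t n).
  by move=> h x; rewrite derivedD; apply: h.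
case: (classic (soluble_le R d)) => [sol|nsol].
  by left; apply: solR; apply: soluble_leW sol => //; apply: gnormal_sub.
case: (dich _ (gnormal_sub (gnormal_derived 1 nR))) => [pR|sol]; last first.
  by left; apply: solR => x; rewrite -addn1 derivedD; apply: sol.
have fR := minimal_insoluble_finite nR pR nsol dich lg.
right; exists (n * t n); split=> //; split=> //.
exact: (almost_minimal_simple_quotient nR pR nsol dich fR).
Qed.
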